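(* Let $p,q\in(0,1)$ with $p\neq q$ and $t>0$ be fixed, and let $$t_c(p,q)=\frac{2}{(\sqrt p-\sqrt q)^2+(\sqrt{1-q}-\sqrt{1-p})^2},\qquad y=y(p,q)=\frac{\log\frac{1-q}{1-p}}{\log\frac pq}.$$ Let $(\sigma_0,G)$ be drawn from $\mathrm{CSBM}(p,q,\alpha)$ on $n$ vertices with $\alpha=t\log n/n$, and let $A$ be the $n\times n$ symmetric matrix with zero diagonal and, for $i\neq j$, $A_{ij}=1$ if $\{i,j\}$ is present, $A_{ij}=-y$ if $\{i,j\}$ is absent, and $A_{ij}=0$ if $\{i,j\}$ is censored. Let $u_1$ be the top eigenvector of $A$ (a unit eigenvector for the largest eigenvalue) and let $\hat\sigma_{\mathrm{Spec}}=\mathrm{sign}(u_1)$, entrywise. If $t>t_c(p,q)$ and $p>q$, then there exist $\eta=\eta(p,q)>0$ and $s\in\{\pm1\}$ such that, with probability $1-o(1)$, $$\sqrt n\,\min_{i\in[n]} s\,\sigma_0(i)(u_1)_i\ \ge\ \eta .$$ Consequently, $\hat\sigma_{\mathrm{Spec}}$ achieves exact recovery for $t>t_c(p,q)$. If $p<q$, all conclusions hold if $A$ is replaced by $-A$.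
   Context: Symmetric censored stochastic block model $\mathrm{CSBM}(p,q,\alpha)$ on vertex set $[n]$: the labels $\sigma_0(i)\in\{\pm1\}$, $i\in[n]$, are i.i.d. uniform. Given $\sigma_0$, independently over unordered pairs $i\ne j$, there is an edge between $i$ and $j$ with probability $p$ if $\sigma_0(i)=\sigma_0(j)$ and with probability $q$ if $\sigma_0(i)\neq\sigma_0(j)$ (no self-loops). Independently over pairs, the status of each pair is revealed with probability $\alpha=t\log n/n$. The observation $G$ assigns to each pair a status in {present, absent, censored}: ''present'' if revealed and an edge, ''absent'' if revealed and a non-edge, ''censored'' if not revealed. An estimator $\hat\sigma\in\{\pm1\}^n$ computed from $G$ achieves exact recovery if $\lim_{n\to\infty}\mathbb{P}(\exists s\in\{\pm1\}:\hat\sigma=s\sigma_0)=1$. $\log$ is the natural logarithm.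
   Formalization: The constant η may depend on t as well as on p and q (no η uniform in t exists, since the minimum entry tends to 0 as t decreases to t_c), and the sign s may depend on the sample (a fixed s fails by the symmetry σ0 → −σ0). *)

(* Defs.v *)
From HB Require Import structures.
From mathcomp Require Import all_boot all_order all_algebra.
From mathcomp Require Import all_classical all_reals all_analysis.
Set Implicit Arguments.
Unset Strict Implicit.
Unset Printing Implicit Defensive.
Import Order.TTheory GRing.Theory Num.Theory.
Import numFieldNormedType.Exports.
Local Open Scope ring_scope.

(* A label in {+1, -1} is encoded by a bool b, standing for (-1) ^+ b: true is
   -1, and the product of two labels is addb. *)
Definition labels (n : nat) := {ffun 'I_n -> bool}.

Definition spin {R : realType} (b : bool) : R := (-1) ^+ b.

Definition vpair (n : nat) := {e : {set 'I_n} | #|e| == 2}.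

Inductive status := Present | Absent | Censored.

Definition observation (n : nat) := {ffun vpair n -> status}.

(* An outcome is (sigma0, E, V): the labels, the edge indicators, and the
   indicators that the status of a pair is revealed. *)
Definition outcome (n : nat) :=
  (labels n * {ffun vpair n -> bool} * {ffun vpair n -> bool})%type.

Definition sigma0 n (w : outcome n) : labels n := w.1.1.

Definition observe n (w : outcome n) : observation n :=
  [ffun e => if w.2 e then if w.1.2 e then Present else Absent else Censored].

Definition same_label n (sigma : labels n) (e : vpair n) : bool :=
  [forall i in val e, forall j in val e, sigma i == sigma j].

(* This is a probability mass function when p, q and alpha are in [0, 1]. *)
Definition csbm_pmf {R : realType} (p q alpha : R) n (w : outcome n) : R :=
  (\prod_(i < n) bernoulli_pmf 2^-1 (w.1.1 i)) *
  (\prod_(e : vpair n)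
     bernoulli_pmf (if same_label w.1.1 e then p else q) (w.1.2 e)) *
  (\prod_(e : vpair n) bernoulli_pmf alpha (w.2 e)).

Definition csbm_pr {R : realType} (p q alpha : R) n (A : pred (outcome n)) : R :=
  \sum_(w : outcome n | A w) csbm_pmf p q alpha w.

(* This may exceed 1, but only for finitely many n, which does not affect the
   limits below. *)
Definition reveal_prob {R : realType} (t : R) (n : nat) : R :=
  t * ln n%:R / n%:R.

Definition with_high_probability {R : realType} (p q t : R)
    (A : forall n, pred (outcome n)) : Prop :=
  ((fun n => csbm_pr p q (reveal_prob t n) (@A n)) @ \oo --> (1 : R))%classic.

Definition exact_recovery {R : realType} (p q t : R)
    (sigma_hat : forall n, observation n -> labels n) : Prop :=
  with_high_probability p q t (fun n (w : outcome n) =>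
    [exists s : bool, forall i : 'I_n,
       sigma_hat n (observe w) i == s (+) sigma0 w i]).

Definition t_c {R : realType} (p q : R) : R :=
  2 / ((Num.sqrt p - Num.sqrt q) ^+ 2 +
       (Num.sqrt (1 - q) - Num.sqrt (1 - p)) ^+ 2).

Definition y_pq {R : realType} (p q : R) : R :=
  ln ((1 - q) / (1 - p)) / ln (p / q).

Definition status_weight {R : realType} (y : R) (x : status) : R :=
  match x with Present => 1 | Absent => - y | Censored => 0 end.

(* On the diagonal [set i; j] is a singleton, so insub gives None. *)
Definition signed_adjacency {R : realType} (y : R) n (G : observation n) :
    'M[R]_n :=
  \matrix_(i, j) if insub [set i; j]%SET is Some e
                 then status_weight y (G e) else 0.

(* Eigenvectors are row vectors, as in mxalgebra; this is immaterial for the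
   symmetric matrices considered here. *)
Definition top_unit_eigenvector {R : realType} n (M : 'M[R]_n) (v : 'rV[R]_n) :
    Prop :=
  \sum_(i < n) v 0 i ^+ 2 = 1 /\
  exists lambda : R,
    [/\ eigenvalue M lambda,
        forall mu : R, eigenvalue M mu -> mu <= lambda
      & (v <= eigenspace M lambda)%MS].

(* A choice of a top eigenvector for each observation; there is no unit vector
   in dimension 0. *)
Definition top_eigenvector_choice {R : realType}
    (M : forall n, observation n -> 'M[R]_n)
    (u : forall n, observation n -> 'rV[R]_n) : Prop :=
  forall n (G : observation n), (0 < n)%N -> top_unit_eigenvector (M n G) (u n G).

(* The sign of 0 is taken to be +1. *)
Definition sign_labels {R : realType} n (v : 'rV[R]_n) : labels n :=
  [ffun i => v 0 i < 0].

(* Main.v *)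
(* With [L] the matrix of log-likelihood ratios ln (P_same / P_diff) of the
   observed statuses, the matrix of the theorem is a positive multiple of [L],
   both for p > q ([A]) and for p < q ([- A]).

   Given the labels s, the mean of [L] is (ln n / n) (c2 11^T + c1 ss^T) with
   |c2| < c1, by positivity of the Kullback-Leibler divergences.  With high
   probability [L] deviates from it by o(ln n) as a quadratic form: vectors with
   entries O(1 / sqrt n) are handled by a union bound over sign vectors, and the
   large entries by the maximal degree and the scarcity of revealed pairs inside
   small sets.  So a top eigenvector u is l^2-close to +-s / sqrt n.

   Entrywise, lam u_k = (L u)_k is compared with the top eigenvector v of the
   matrix with row and column k censored.  Since u - <u,v> v has norm O(|u_k|),
   its contribution is o(ln n) |u_k|; since v is independent of row k, the
   deviation v -+ s / sqrt n contributes o(ln n / sqrt n); what remains is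
   sum_j L_kj s_j / sqrt n, and s_k sum_j L_kj s_j >= c ln n for all k by
   Chernoff's bound at exponent 1/2, where t > t_c makes the union bound over
   the n rows converge. *)
Require Import Defs.
From HB Require Import structures.
From mathcomp Require Import all_boot all_order all_algebra.
From mathcomp Require Import all_classical all_reals all_analysis.
From mathcomp Require Import ring lra.
Import Order.TTheory GRing.Theory Num.Theory.
Import numFieldNormedType.Exports.
Set Implicit Arguments.
Unset Strict Implicit.
Unset Printing Implicit Defensive.
Local Open Scope ring_scope.

(** * Quadratic forms and Rayleigh quotients *)

(** The obstacle is the passage from l^2 to single entries: closeness of [u] to a label vector in
    l^2 says nothing about one entry of size 1 / sqrt n. The leave-one-out errors at row [k] are
    bounded by |u k| and by the sup norm of [u] itself, so the comparison is used twice: at the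
    entry of largest modulus, where it shows that the sup norm is O(1 / sqrt n), and then at an
    arbitrary entry.

    Perturbation theory of eigenvectors is replaced by quadratic forms. A top eigenvector enters
    only through its equation and the maximality of its Rayleigh quotient, and the spectral gap is
    read off from the form on the orthogonal complement. The argument therefore covers every choice
    of top eigenvectors. As a choice is a function of the observation, its value at a censored
    observation supplies the vector [v], independent of the reveal indicators of row [k].

    The randomness is confined to six events, each controlled by one exponential moment and a union
    bound; what follows from them is deterministic. *)

Section FiniteLinearAlgebra.
Context {R : realType} {n : nat}.
Implicit Types (x y z : 'I_n -> R) (M : 'I_n -> 'I_n -> R) (c : R).

Definition dot x y : R := \sum_i x i * y i.
Definition mulmv M y : 'I_n -> R := fun i => \sum_j M i j * y j.

Lemma dotC x y : dot x y = dot y x.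
Proof. by apply: eq_bigr => i _; rewrite mulrC. Qed.

Lemma eq_dot x x' y y' : x =1 x' -> y =1 y' -> dot x y = dot x' y'.
Proof. by move=> ex ey; apply: eq_bigr => i _; rewrite ex ey. Qed.

Lemma dotDl x y z : dot (fun i => x i + y i) z = dot x z + dot y z.
Proof. by rewrite -big_split; apply: eq_bigr => i _; rewrite mulrDl. Qed.

Lemma dotDr x y z : dot z (fun i => x i + y i) = dot z x + dot z y.
Proof. by rewrite dotC dotDl !(dotC z). Qed.

Lemma dotZl c x z : dot (fun i => c * x i) z = c * dot x z.
Proof. by rewrite mulr_sumr; apply: eq_bigr => i _; rewrite mulrA. Qed.

Lemma dotZr c x z : dot z (fun i => c * x i) = c * dot z x.
Proof. by rewrite dotC dotZl dotC. Qed.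

Lemma dot_ge0 x : 0 <= dot x x.
Proof. by apply: sumr_ge0 => i _; rewrite -expr2 sqr_ge0. Qed.

Lemma le_dot x i : x i ^+ 2 <= dot x x.
Proof.
rewrite /dot (bigD1 i) //= -expr2 lerDl.
by apply: sumr_ge0 => j _; rewrite -expr2 sqr_ge0.
Qed.

Lemma dot_eq0 x : dot x x = 0 -> x =1 (fun=> 0).
Proof.
move=> x0 i; have := le_dot x i; rewrite x0 => h.
by apply/eqP; rewrite -sqrf_eq0 eq_le h sqr_ge0.
Qed.

Lemma cauchy_schwarz x y : dot x y ^+ 2 <= dot x x * dot y y.
Proof.
have [x0|xn0] := eqVneq (dot x x) 0.
  have /dot_eq0 e := x0.
  by rewrite x0 mul0r /dot big1 ?expr0n // => i _; rewrite e mul0r.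
have xp : 0 < dot x x by rewrite lt_neqAle eq_sym xn0 dot_ge0.
have := dot_ge0 (fun i => dot x x * y i + - dot x y * x i).
rewrite !(dotDl, dotDr, dotZl, dotZr) (dotC y x) => h.
suff : 0 <= dot x x * (dot x x * dot y y - dot x y ^+ 2).
  by rewrite pmulr_rge0 // subr_ge0.
by apply: le_trans h _; rewrite le_eqVlt; apply/orP; left; apply/eqP; ring.
Qed.

Lemma dot_delta_l i x : dot (fun j => (j == i)%:R) x = x i.
Proof.
rewrite /dot (bigD1 i) //= eqxx mul1r big1 ?addr0 // => j /negbTE ->.
by rewrite mul0r.
Qed.

Lemma mulmvD M x y :
  mulmv M (fun i => x i + y i) =1 (fun i => mulmv M x i + mulmv M y i).
Proof. by move=> i; rewrite -big_split; apply: eq_bigr => j _; rewrite mulrDr. Qed.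

Lemma mulmvZ M c x : mulmv M (fun i => c * x i) =1 (fun i => c * mulmv M x i).
Proof. by move=> i; rewrite mulr_sumr; apply: eq_bigr => j _; rewrite mulrCA. Qed.

Lemma eq_mulmv M x y : x =1 y -> mulmv M x =1 mulmv M y.
Proof. by move=> e i; apply: eq_bigr => j _; rewrite e. Qed.

Lemma dot_mulmv M x y : dot x (mulmv M y) = \sum_i \sum_j M i j * (x i * y j).
Proof.
by apply: eq_bigr => i _; rewrite mulr_sumr; apply: eq_bigr => j _; ring.
Qed.

Lemma dot_mulmvC M x y : (forall i j, M i j = M j i) ->
  dot x (mulmv M y) = dot y (mulmv M x).
Proof.
move=> sM; rewrite !dot_mulmv exchange_big; apply: eq_bigr => i _.
by apply: eq_bigr => j _; rewrite sM (mulrC (x _)).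
Qed.

Lemma mulmv_quadD M x y : (forall i j, M i j = M j i) ->
  dot (fun i => x i + y i) (mulmv M (fun i => x i + y i)) =
  dot x (mulmv M x) + 2 * dot x (mulmv M y) + dot y (mulmv M y).
Proof.
move=> sM; rewrite (eq_dot (fun=> erefl) (mulmvD M x y)) !(dotDl, dotDr).
by rewrite (dot_mulmvC y x sM); ring.
Qed.

Lemma dotD2 x y : dot (fun i => x i + y i) (fun i => x i + y i) =
  dot x x + 2 * dot x y + dot y y.
Proof. by rewrite !(dotDl, dotDr) (dotC y x); ring. Qed.

Lemma mulmv_quadZ M c x :
  dot (fun i => c * x i) (mulmv M (fun i => c * x i)) =
  c ^+ 2 * dot x (mulmv M x).
Proof. by rewrite (eq_dot (fun=> erefl) (mulmvZ M c x)) dotZl dotZr; ring. Qed.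

(* The variations [v + s (M v - m v)] with small [s] force [M v = m v]. *)
Lemma rayleigh_maximizer M m : (forall i j, M i j = M j i) ->
  forall v, dot v (mulmv M v) = m * dot v v ->
  (forall x, dot x (mulmv M x) <= m * dot x x) ->
  mulmv M v =1 (fun i => m * v i).
Proof.
move=> sM v vm mx.
pose y i := mulmv M v i + - m * v i.
suff /dot_eq0 y0 : dot y y = 0.
  by move=> i; have := y0 i; rewrite /y => /eqP; rewrite mulNr subr_eq0 => /eqP.
set K := m * dot y y - dot y (mulmv M y).
have K0 : 0 <= K by rewrite subr_ge0 mx.
set P := dot y y.
have Py : P = dot v (mulmv M y) - m * dot v y.
  rewrite (dot_mulmvC v y sM) (dotC v y) -dotZr /P {2}/y dotDr dotZr.
  by rewrite dotZr; ring.
have K1 : 0 < K + 1 by lra.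
have key : P ^+ 2 * (K + 2) <= 0.
  (* The best multiple of [y] would be [P / K], but [K] may vanish; [K + 1] still forces
     [P ^+ 2 * (K + 2) <= 0]. *)
  have := mx (fun i => v i + (P / (K + 1)) * y i).
  rewrite mulmv_quadD // dotD2 mulmv_quadZ dotZr vm.
  rewrite (eq_dot (fun=> erefl) (mulmvZ M _ y)) dotZr dotZl dotZr.
  set s := P / (K + 1) => h.
  have h2 : 2 * s * P <= s ^+ 2 * K by rewrite /K mulrBr {1}Py; lra.
  have sP : P = s * (K + 1) by rewrite /s divfK // gt_eqF.
  move: h2; rewrite sP => h2.
  have s2 : 0 <= s ^+ 2 by apply: sqr_ge0.
  have : s ^+ 2 * (K + 2) <= 0 by lra.
  rewrite pmulr_lle0; last lra.
  move=> s0; have s2z : s ^+ 2 = 0 by apply: le_anti; rewrite s0 s2.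
  by rewrite exprMn s2z !mul0r.
move: key; rewrite pmulr_lle0; last lra.
by move=> h; apply/eqP; rewrite -sqrf_eq0 eq_le h sqr_ge0.
Qed.

End FiniteLinearAlgebra.

Lemma dot_continuous (R : realType) n (f g : 'rV[R]_n.+1 -> 'I_n.+1 -> R) :
  (forall i, continuous (f^~ i)) -> (forall i, continuous (g^~ i)) ->
  continuous (fun v => dot (f v) (g v)).
Proof.
move=> cf cg; rewrite /dot.
apply: (@continuous_big R _ +%R 0 predT) => [|i _ v]; first exact: add_continuous.
by apply: (@continuousM _ _ (f^~ i) (g^~ i)); [exact: cf|exact: cg].
Qed.

(** By compactness the form attains its maximum on the unit sphere; by [rayleigh_maximizer] a
    maximizer is an eigenvector, so the maximum is an eigenvalue and at most [lam]. *)
Lemma rayleigh_le (R : realType) n (M : 'M[R]_n) (lam : R) :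
  M^T = M -> (forall mu, eigenvalue M mu -> mu <= lam) ->
  forall x : 'I_n -> R, dot x (mulmv M x) <= lam * dot x x.
Proof.
case: n M => [|n] M sM top x; first by rewrite /dot !big_ord0 mulr0.
have sM' i j : M i j = M j i by rewrite -{1}sM mxE.
pose f (v : 'rV[R]_n.+1) := dot (v 0) (mulmv M (v 0)).
pose g (v : 'rV[R]_n.+1) := dot (v 0) (v 0).
have cc (j : 'I_n.+1) : continuous (fun v : 'rV[R]_n.+1 => v 0 j).
  exact: coord_continuous.
have gc : continuous g by apply: dot_continuous.
have fc : continuous f.
  apply: dot_continuous => // i; apply: (@dot_continuous _ _ (fun=> M i)) => // j.
  exact: cst_continuous.
pose S := [set v : 'rV[R]_n.+1 | g v = 1]%classic.
have Sc : compact S.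
  apply: bounded_closed_compact; last first.
    by apply: (@preimage_closed _ _ g [set x | x = 1]%classic) => [v _|]; [exact: gc|exact: closed_eq].
  exists 1; split=> // K K1 v Sv.
  rewrite /= [leLHS]/Num.norm /= mx_normrE; apply: bigmax_le => [|[i j] _ /=]; first lra.
  rewrite ord1; apply: le_trans (ltW K1).
  rewrite -(@expr_le1 _ 2%N) // real_normK ?num_real //.
  by rewrite -Sv; apply: (le_dot (v 0)).
have S0 : (S !=set0)%classic.
  exists (\row_j (j == 0)%:R); rewrite /S /= /g.
  rewrite (eq_dot (x' := fun j => (j == 0)%:R) (y' := fun j => (j == 0)%:R)).
  - by rewrite dot_delta_l eqxx.
  - by move=> j; rewrite mxE.
  - by move=> j; rewrite mxE.
have [c cS cmax] := compact_EVT_max S0 Sc (continuous_subspaceT fc).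
rewrite inE in cS; rewrite /= in cmax.
set m := dot (c 0) (mulmv M (c 0)) in cmax.
have mx (y : 'I_n.+1 -> R) : dot y (mulmv M y) <= m * dot y y.
  have [y0|yn0] := eqVneq (dot y y) 0.
    have e := dot_eq0 y0; rewrite y0 mulr0.
    by rewrite (eq_dot e (fun=> erefl)) /dot big1 // => i _; rewrite mul0r.
  have yp : 0 < dot y y by rewrite lt_neqAle eq_sym yn0 dot_ge0.
  set s := Num.sqrt (dot y y).
  have sp : 0 < s by rewrite sqrtr_gt0.
  have ss : s ^+ 2 = dot y y by rewrite sqr_sqrtr // ltW.
  pose v : 'rV[R]_n.+1 := \row_j (s^-1 * y j).
  have ve : v 0 =1 (fun j => s^-1 * y j) by move=> j; rewrite mxE.
  have gv : g v = 1.
    rewrite /g (eq_dot ve ve) dotZl dotZr -ss mulrA -expr2 -exprMn mulVf ?expr1n ?gt_eqF //.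
  have := cmax v (mem_set gv); rewrite -/m /f (eq_dot ve (eq_mulmv _ ve)).
  rewrite mulmv_quadZ -ss.
  move=> h; have : s ^+ 2 * (s^-1 ^+ 2 * dot y (mulmv M y)) <= s ^+ 2 * m.
    by rewrite ler_pM2l // exprn_gt0.
  by rewrite mulrA -exprMn divff ?gt_eqF // expr1n mul1r mulrC.
have c1 : dot (c 0) (c 0) = 1 := cS.
have cm : dot (c 0) (mulmv M (c 0)) = m * dot (c 0) (c 0) by rewrite c1 mulr1.
have ev := rayleigh_maximizer sM' cm mx.
apply: le_trans (mx x) _; rewrite ler_wpM2r ?dot_ge0 //; apply: top.
apply/eigenvalueP; exists c.
  apply/rowP => j; rewrite !mxE -ev; apply: eq_bigr => i _.
  by rewrite sM' mulrC.
by apply/eqP => c0; move: c1; rewrite c0 /dot big1 => [/eqP|i _]; rewrite ?mxE ?mul0r // eq_sym oner_eq0.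
Qed.

Lemma top_unit_eigenvectorP (R : realType) n (M : 'M[R]_n) (v : 'rV[R]_n) :
  M^T = M -> top_unit_eigenvector M v -> dot (v 0) (v 0) = 1 /\
  exists lam : R, mulmv M (v 0) =1 (fun i => lam * v 0 i) /\
    forall x : 'I_n -> R, dot x (mulmv M x) <= lam * dot x x.
Proof.
move=> sM [v1 [lam [_ top /eigenspaceP ev]]]; split.
  by rewrite -v1; apply: eq_bigr => i _; rewrite expr2.
exists lam; split; last exact: rayleigh_le.
move=> j; have := congr1 (fun w : 'rV_n => w 0 j) ev; rewrite !mxE => <-.
by apply: eq_bigr => i _; rewrite -{1}sM mxE mulrC.
Qed.

Lemma spin_sq (R : realType) (b : bool) : spin b * spin b = 1 :> R.
Proof. by rewrite /spin -expr2 sqrr_sign. Qed.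

Lemma normr_spin (R : realType) (b : bool) : `|spin b| = 1 :> R.
Proof. exact: normr_sign. Qed.

Lemma spin_ltr0 (R : realType) (a : R) : spin (a < 0) * a = `|a|.
Proof.
by rewrite /spin; case: ltrP => a0; rewrite ?expr1 ?expr0 ?mul1r ?mulN1r;
  [rewrite ltr0_norm|rewrite ger0_norm].
Qed.

(** * From sign vectors and indicator vectors to general vectors *)

Section QuadraticForms.
Context {R : realType} {n : nat}.
Implicit Types (x y z : 'I_n -> R) (V W : 'I_n -> 'I_n -> R).

Lemma sum_le_norm m (a y : 'I_n -> R) : (forall i, `|y i| <= m) ->
  \sum_i y i * a i <= m * \sum_i `|a i|.
Proof.
move=> ym; rewrite mulr_sumr; apply: ler_sum => i _.
by rewrite (le_trans (ler_norm _)) // normrM ler_wpM2r.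
Qed.

(** A bilinear form on a product of cubes is largest at vertices: [y], and then [z], is replaced by
    the signs of the sums that it multiplies. *)
Lemma dot_mulmv_cube W (Q m : R) y z : 0 <= m ->
  (forall s r : 'I_n -> bool, \sum_i \sum_j spin (s i) * spin (r j) * W i j <= Q) ->
  (forall i, `|y i| <= m) -> (forall i, `|z i| <= m) ->
  dot y (mulmv W z) <= m ^+ 2 * Q.
Proof.
move=> m0 WQ ym zm; apply: le_trans (sum_le_norm _ ym) _.
pose s i := mulmv W z i < 0.
have -> : \sum_i `|mulmv W z i| =
    \sum_j z j * \sum_i spin (s i) * W i j.
  transitivity (\sum_i \sum_j z j * (spin (s i) * W i j)).
    apply: eq_bigr => i _; rewrite -spin_ltr0 mulr_sumr; apply: eq_bigr => j _.
    by rewrite -/(s i); ring.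
  by rewrite exchange_big; apply: eq_bigr => j _; rewrite mulr_sumr.
rewrite expr2 -mulrA ler_wpM2l //; apply: le_trans (sum_le_norm _ zm) _.
rewrite ler_wpM2l //; apply: le_trans (WQ s (fun j => \sum_i spin (s i) * W i j < 0)).
rewrite exchange_big; apply: ler_sum => j _.
rewrite -spin_ltr0 mulr_sumr; apply: ler_sum => i _.
by rewrite mulrCA mulrA.
Qed.

(* Removing the smallest positive value of [f] from its whole support lowers
   both sides by comparable amounts. *)
Lemma layer_cake V (k : R) (f : 'I_n -> R) : 0 <= k ->
  (forall i, 0 <= f i) ->
  (forall T : {set 'I_n}, (forall i, i \in T -> 0 < f i) ->
     \sum_(i in T) \sum_(j in T) V i j <= k * #|T|%:R) ->
  \sum_i \sum_j V i j * Num.min (f i) (f j) <= k * \sum_i f i.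
Proof.
move=> k0; move: {2}#|_|.+1 (ltnSn #|[set i | 0 < f i]|) => N.
elim: N f => // N IH f fN f0 dens.
set T := [set i | 0 < f i] in fN.
have fT i : (i \in T) = (0 < f i) by rewrite inE.
have fnT i : i \notin T -> f i = 0.
  by rewrite fT -leNgt => h; apply: le_anti; rewrite h f0.
have [T0|[i0 i0T]] := set_0Vmem T.
  have fz i : f i = 0 by apply: fnT; rewrite T0 inE.
  rewrite big1 => [|i _]; first by rewrite mulr_ge0 // sumr_ge0.
  by rewrite big1 // => j _; rewrite !fz minxx mulr0.
have [m /= mT mmin] := @arg_minP _ _ _ i0 (mem T) f i0T.
have {}mT : m \in T by [].
set c := f m in mmin.
have c0 : 0 < c by rewrite -fT.
pose g i := if i \in T then f i - c else 0.
have g0 i : 0 <= g i by rewrite /g; case: ifP => // iT; rewrite subr_ge0 mmin.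
have gT i : 0 < g i -> 0 < f i.
  by rewrite /g -fT; case: ifP => //; rewrite ltxx.
have gm : (#|[set i | (0 < g i)%R]| < N)%N.
  rewrite -ltnS; apply: leq_trans fN; rewrite ltnS; apply: proper_card.
  apply/properP; split; first by apply/fintype.subsetP => i; rewrite !inE => /gT.
  by exists m => //; rewrite !inE /g mT subrr ltxx.
have := IH g gm g0 (fun S h => dens S (fun i iS => gT i (h i iS))).
have eg : \sum_i f i = \sum_i g i + c * #|T|%:R.
  rewrite -sum1_card natr_sum mulr_sumr [X in _ + X]big_mkcond -big_split /=.
  apply: eq_bigr => i _; rewrite /g; case: ifPn => [|/fnT ->]; lra.
have -> : \sum_i \sum_j V i j * Num.min (f i) (f j) =
    \sum_i \sum_j V i j * Num.min (g i) (g j) +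
    c * \sum_(i in T) \sum_(j in T) V i j.
  rewrite mulr_sumr [X in _ + X]big_mkcond -big_split; apply: eq_bigr => i _ /=.
  case: ifPn => iT; last first.
    rewrite addr0; apply: eq_bigr => j _; rewrite {1}(fnT _ iT) /g (negbTE iT).
    by case: ifP => jT; rewrite !min_l // subr_ge0 mmin.
  rewrite mulr_sumr [X in _ + X]big_mkcond -big_split; apply: eq_bigr => j _ /=.
  rewrite /g iT; case: ifPn => jT; last first.
    by rewrite addr0 (fnT _ jT) !min_r // subr_ge0 mmin.
  rewrite mulrC [X in _ + X]mulrC -mulrDr mulrC; congr (_ * _).
  by rewrite -{1}(subrK c (f i)) -{1}(subrK c (f j)) addr_minl.
move=> h; rewrite eg mulrDr lerD // mulrCA ler_wpM2l ?(ltW c0) //.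
by apply: dens => i; rewrite fT.
Qed.

End QuadraticForms.

(** * Quadratic forms of sparse matrices *)

Lemma sum_norm_le_sqrt (R : realType) n (x : 'I_n -> R) :
  \sum_i `|x i| <= Num.sqrt n%:R * Num.sqrt (dot x x).
Proof.
rewrite -sqrtrM ?ler0n //; apply: le_trans (ler_norm _) _.
rewrite -sqrtr_sqr ler_wsqrtr //.
have := cauchy_schwarz (fun=> 1) (fun i => `|x i|).
rewrite /dot; under eq_bigr do rewrite mul1r.
have -> : \sum_(i < n) (1 * 1 : R) = n%:R by rewrite mulr1 sumr_const card_ord.
have -> // : \sum_i `|x i| * `|x i| = \sum_i x i * x i.
by apply: eq_bigr => i _; rewrite -normrM ger0_norm // -expr2 sqr_ge0.
Qed.

(* If one of two entries exceeds the threshold [tau], either they are of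
   different magnitude, or both exceed [e * tau]. *)
Lemma large_pair_bound (R : realFieldType) (e tau a b : R) (f : R -> R) :
  (forall t, 0 <= f t) -> (forall t, e * tau < t -> f t = t ^+ 2) -> 0 < e <= 1 ->
  0 <= a -> 0 <= b -> 0 < tau -> (tau < a) || (tau < b) ->
  a * b <= 3 / 2 * e * (a ^+ 2 + b ^+ 2) + (2 * e)^-1 * Num.min (f a) (f b).
Proof.
move=> f0 fE /andP[e0 e1] a0 b0 tau0 h.
wlog ab : a b a0 b0 h / b <= a.
  move=> H; have [ba|/ltW ab] := lerP b a; first exact: H.
  by have := H b a b0 a0; rewrite orbC minC (addrC (b ^+ 2)) (mulrC b); apply.
have ta : tau < a by case/orP: h => // /lt_le_trans; apply.
have i0 : 0 < (2 * e)^-1 by rewrite invr_gt0 mulr_gt0.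
have [bea|bea] := lerP b (e * a).
  have h1 : a * b <= e * a ^+ 2.
    by rewrite expr2 mulrCA ler_wpM2l.
  have h2 : 0 <= (2 * e)^-1 * Num.min (f a) (f b).
    by rewrite mulr_ge0 ?(ltW i0) // le_min !f0.
  have h3 : 0 <= e * b ^+ 2 by rewrite mulr_ge0 ?sqr_ge0 // ltW.
  have h4 : 0 <= e * a ^+ 2 by rewrite mulr_ge0 ?sqr_ge0 // ltW.
  move: h2; set w := (2 * e)^-1 * _ => h2; lra.
have eta : e * tau < b by apply: lt_trans bea; rewrite ltr_pM2l.
have etaa : e * tau < a by apply: lt_le_trans eta ab.
rewrite !fE // min_r ?ler_sqr ?nnegrE //.
have eu : e * (2 * e)^-1 = 1 / 2 by field; lra.
move: eu i0; move: (2 * e)^-1 => u eu i0.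
(* Completing the square with [u = 1 / (2 e)] gives [a * b <= u * b ^+ 2 + e * a ^+ 2 / 2]. *)
have h1 : 0 <= u * (b - e * a) ^+ 2 by rewrite mulr_ge0 ?sqr_ge0 // ltW.
have e2 : u * (b - e * a) ^+ 2 = u * b ^+ 2 - a * b + 1 / 2 * (e * a ^+ 2).
  transitivity (u * b ^+ 2 - 2 * (e * u) * (a * b) + (e * u) * (e * a ^+ 2)); first by ring.
  by rewrite eu; field.
have h3 : 0 <= e * b ^+ 2 by rewrite mulr_ge0 ?sqr_ge0 // ltW.
have h4 : 0 <= e * a ^+ 2 by rewrite mulr_ge0 ?sqr_ge0 // ltW.
rewrite e2 in h1; lra.
Qed.

Lemma quad_bound_unit (R : realType) n (V W : 'I_n -> 'I_n -> R)
    (B C D d e l : R) (x : 'I_n -> R) :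
  (0 < n)%N -> 0 < d <= 1 -> 0 < e <= 1 -> 0 <= l -> 0 <= B -> 0 <= C ->
  (forall i j, 0 <= V i j) -> (forall i j, V i j = V j i) ->
  (forall i j, `|W i j| <= B * V i j + C * (l / n%:R)) ->
  (forall i, \sum_j V i j <= D * l) ->
  (forall T : {set 'I_n}, #|T|%:R <= d ^+ 2 * n%:R ->
     \sum_(i in T) \sum_(j in T) V i j <= e ^+ 2 * l * #|T|%:R) ->
  (forall s r : 'I_n -> bool,
     \sum_i \sum_j spin (s i) * spin (r j) * W i j <= e ^+ 3 * d ^+ 2 * (n%:R * l)) ->
  dot x x = 1 ->
  `|dot x (mulmv W x)| <= e * (1 + 2 * C + B * (3 * D + 1)) * l.
Proof.
move=> n0 /andP[d0 d1] /andP[e0 e1] l0 B0 C0 V0 sV WV degV denseV flatW x1.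
have nR0 : 0 < n%:R :> R by rewrite ltr0n.
set rn : R := Num.sqrt n%:R.
have rn0 : 0 < rn by rewrite sqrtr_gt0.
have rn2 : rn ^+ 2 = n%:R by rewrite sqr_sqrtr // ltW.
(* Products of two entries below [tau] are controlled by [flatW]; in the other
   products [x i * x j], either one factor is much smaller than the other and
   the degrees suffice, or both are large and [denseV] applies. *)
pose tau := (e * d * rn)^-1.
have tau0 : 0 < tau by rewrite invr_gt0 !mulr_gt0.
pose S i := tau < `|x i|.
pose y i := if S i then 0 else x i.
have ytau i : `|y i| <= tau.
  by rewrite /y /S; case: ltrP => // _; rewrite normr0 ltW.
have flat1 z : (forall i, `|z i| <= tau) -> dot z (mulmv W y) <= e * l.
  move=> ztau; apply: le_trans (dot_mulmv_cube (ltW tau0) flatW ztau ytau) _.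
  rewrite le_eqVlt; apply/orP; left; apply/eqP.
  rewrite /tau -rn2; field; rewrite !gt_eqF //.
have flat2 : `|dot y (mulmv W y)| <= e * l.
  rewrite ler_norml flat1 // andbT lerNl -mulN1r -dotZl flat1 // => i.
  by rewrite mulN1r normrN.
pose G i j := if S i || S j then `|x i| * `|x j| else 0.
have rest : `|dot x (mulmv W x) - dot y (mulmv W y)| <=
    B * (\sum_i \sum_j V i j * G i j) + C * (l / n%:R) * \sum_i \sum_j G i j.
  rewrite !dot_mulmv !mulr_sumr -sumrB -big_split.
  apply: le_trans (ler_norm_sum _ _ _) _; apply: ler_sum => i _ /=.
  rewrite -sumrB !mulr_sumr -big_split; apply: le_trans (ler_norm_sum _ _ _) _.
  apply: ler_sum => j _ /=.
  rewrite -mulrBr normrM [X in _ <= X](_ : _ = (B * V i j + C * (l / n%:R)) * G i j); last by ring.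
  apply: le_trans (_ : _ <= `|W i j| * G i j) _; last first.
    by rewrite ler_wpM2r // /G; case: ifP => // _; rewrite mulr_ge0.
  rewrite ler_wpM2l // /G /y; case: (S i) => /=.
    by rewrite mul0r subr0 normrM.
  by case: (S j); rewrite ?mulr0 ?subr0 ?normrM // subrr normr0.
have sx2 i : \sum_j (x i ^+ 2 * V i j) <= x i ^+ 2 * (D * l).
  by rewrite -mulr_sumr ler_wpM2l // sqr_ge0.
have sx1 : \sum_i x i ^+ 2 = 1 by rewrite -x1; apply: eq_bigr => i _; rewrite expr2.
have degx : \sum_i \sum_j V i j * (x i ^+ 2 + x j ^+ 2) <= 2 * (D * l).
  have -> : \sum_i \sum_j V i j * (x i ^+ 2 + x j ^+ 2) =
      \sum_i \sum_j x i ^+ 2 * V i j + \sum_i \sum_j x i ^+ 2 * V i j.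
    rewrite [X in _ + X]exchange_big -big_split; apply: eq_bigr => i _ /=.
    by rewrite -big_split; apply: eq_bigr => j _ /=; rewrite (sV j i); ring.
  suff : \sum_i \sum_j x i ^+ 2 * V i j <= D * l by lra.
  by rewrite -[leRHS]mul1r -sx1 mulr_suml ler_sum.
pose f i := if e * tau < `|x i| then `|x i| ^+ 2 else 0.
have f0 i : 0 <= f i by rewrite /f; case: ifP => // _; rewrite sqr_ge0.
have fx i : f i <= x i ^+ 2.
  by rewrite /f; case: ifP => // _; [rewrite real_normK ?num_real|rewrite sqr_ge0].
have lc : \sum_i \sum_j V i j * Num.min (f i) (f j) <= e ^+ 2 * l.
  have el0 : 0 <= e ^+ 2 * l by rewrite mulr_ge0 ?sqr_ge0.
  apply: le_trans (layer_cake el0 f0 _) _; last first.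
    by rewrite -[leRHS]mulr1 ler_wpM2l // -sx1 ler_sum.
  move=> T fT; apply: denseV.
  have : \sum_(i in T) (e * tau) ^+ 2 <= \sum_i x i ^+ 2.
    rewrite [X in _ <= X](bigID (mem T)) /= -[leLHS]addr0 lerD //; last first.
      by apply: sumr_ge0 => i _; rewrite sqr_ge0.
    apply: ler_sum => i iT; apply: le_trans (fx i).
    have := fT i iT; rewrite /f; case: ifP => [h _|]; last by rewrite ltxx.
    by rewrite ler_sqr ?nnegrE ?mulr_ge0 // ltW.
  have -> : (e * tau) ^+ 2 = (d ^+ 2 * n%:R)^-1.
    by rewrite /tau -rn2; field; rewrite !gt_eqF.
  by rewrite sx1 sumr_const -[leLHS]mulr_natl ler_pdivrMr ?mul1r // mulr_gt0 ?exprn_gt0.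
have GV : \sum_i \sum_j V i j * G i j <= e * (3 * D + 1) * l.
  apply: le_trans (_ : _ <= 3 / 2 * e * (2 * (D * l)) + (2 * e)^-1 * (e ^+ 2 * l)) _; last first.
    have -> : (2 * e)^-1 * (e ^+ 2 * l) = 1 / 2 * (e * l) by field; rewrite gt_eqF.
    have : 0 <= e * l by rewrite mulr_ge0 // ltW.
    lra.
  apply: le_trans (_ : _ <= 3 / 2 * e * \sum_i \sum_j V i j * (x i ^+ 2 + x j ^+ 2) + (2 * e)^-1 * \sum_i \sum_j V i j * Num.min (f i) (f j)) _; last first.
    rewrite lerD // ler_wpM2l //; first lra.
    by rewrite invr_ge0 mulr_ge0 // ltW.
  rewrite !mulr_sumr -big_split; apply: ler_sum => i _ /=.
  rewrite !mulr_sumr -big_split; apply: ler_sum => j _ /=.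
  rewrite [X in _ <= X](_ : _ = V i j * (3 / 2 * e * (x i ^+ 2 + x j ^+ 2) + (2 * e)^-1 * Num.min (f i) (f j))); last by ring.
  rewrite ler_wpM2l // /G; case: ifPn => Sij; last first.
    rewrite addr_ge0 // mulr_ge0 //; first by lra.
    - by rewrite addr_ge0 // sqr_ge0.
    - by rewrite invr_ge0 mulr_ge0 // ltW.
    - by rewrite le_min !f0.
  pose F t := if e * tau < t then t ^+ 2 else 0.
  have F0 t : 0 <= F t by rewrite /F; case: ifP => // _; rewrite sqr_ge0.
  have FE t : e * tau < t -> F t = t ^+ 2 by rewrite /F => ->.
  have e01 : 0 < e <= 1 by rewrite e0.
  have := large_pair_bound F0 FE e01 (normr_ge0 _) (normr_ge0 _) tau0 Sij.
  by rewrite !real_normK ?num_real.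
have G1 : \sum_i \sum_j G i j <= 2 * (e * n%:R).
  pose g i := if S i then `|x i| else 0.
  (* An entry above [tau] satisfies [|x i| <= x i ^+ 2 / tau], and the squares sum to 1. *)
  have Sg : \sum_i g i <= e * rn.
    apply: le_trans (_ : _ <= \sum_i (x i ^+ 2) / tau) _; last first.
      rewrite -mulr_suml sx1 mul1r /tau invrK ler_wpM2r ?(ltW rn0) //.
      by rewrite ler_piMr // ltW.
    apply: ler_sum => i _; rewrite /g /S; case: ltrP => [h|_].
      by rewrite ler_pdivlMr // -real_normK ?num_real // expr2 ler_wpM2l // ltW.
    by rewrite divr_ge0 ?sqr_ge0 // ltW.
  have Sx : \sum_i `|x i| <= rn.
    by apply: le_trans (sum_norm_le_sqrt x) _; rewrite x1 sqrtr1 mulr1.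
  apply: le_trans (_ : _ <= \sum_i \sum_j (g i * `|x j| + `|x i| * g j)) _.
    apply: ler_sum => i _; apply: ler_sum => j _; rewrite /G /g.
    by case: (S i); case: (S j); rewrite /= ?mul0r ?mulr0 ?addr0 ?add0r // lerDl mulr_ge0.
  under eq_bigr do rewrite big_split -!mulr_sumr /=.
  rewrite big_split -!mulr_suml /=.
  have : (\sum_i g i) * (\sum_i `|x i|) <= (e * rn) * rn.
    apply: ler_pM => //; apply: sumr_ge0 => // i _; rewrite /g; case: ifP => //.
  have -> : e * rn * rn = e * n%:R by rewrite -rn2; ring.
  rewrite (mulrC (\sum_i `|x i|)); lra.
apply: le_trans (_ : _ <= e * l + (B * (e * (3 * D + 1) * l) + C * (l / n%:R) * (2 * (e * n%:R)))) _.
  rewrite -[X in `|X|](subrK (dot y (mulmv W y))) addrC.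
  apply: le_trans (ler_normD _ _) _; rewrite lerD //.
  apply: le_trans rest _; rewrite lerD // ?ler_wpM2l //.
  by rewrite mulr_ge0 // divr_ge0 // ltW.
rewrite le_eqVlt; apply/orP; left; apply/eqP.
field; rewrite gt_eqF //.
Qed.

(** * Perturbation of a rank-two mean *)

Definition uniform_vec {R : realType} {n : nat} : 'I_n -> R :=
  fun=> (Num.sqrt n%:R)^-1.

Definition label_vec {R : realType} {n : nat} (s : 'I_n -> R) : 'I_n -> R :=
  fun i => s i / Num.sqrt n%:R.

(** The formula is kept on the diagonal, where the random matrix vanishes, so that the rank is at
    most two; the diagonal entries are only O([l / n]). *)
Definition mean_mx {R : realType} {n : nat} (s : 'I_n -> R) (l c1 c2 : R) :
    'I_n -> 'I_n -> R :=
  fun i j => l / n%:R * (c2 + c1 * (s i * s j)).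

(** For symmetric matrices this is the operator norm bound |L - N| <= eps, in the form used to
    compare Rayleigh quotients. *)
Definition quad_close {R : realType} {n : nat} (eps : R)
    (L N : 'I_n -> 'I_n -> R) : Prop :=
  forall x, `|dot x (mulmv L x) - dot x (mulmv N x)| <= eps * dot x x.

Section RankTwoMean.
Context {R : realType} {n : nat} (s : 'I_n -> R) (l c1 c2 : R).
Hypothesis n0 : (0 < n)%N.
Hypothesis s2 : forall i, s i ^+ 2 = 1.
Hypothesis l0 : 0 < l.
Hypothesis c2_lt : `|c2| < c1.
Implicit Types (x u v r : 'I_n -> R) (L : 'I_n -> 'I_n -> R).

Local Notation rn := (Num.sqrt n%:R : R).
Local Notation z := (label_vec s).
Local Notation o := (@uniform_vec R n).
Local Notation N := (mean_mx s l c1 c2).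
Local Notation g := (c1 - `|c2|).

Let nR0 : 0 < n%:R :> R. Proof. by rewrite ltr0n. Qed.
Let rn0 : 0 < rn. Proof. by rewrite sqrtr_gt0. Qed.
Let rn2 : rn ^+ 2 = n%:R. Proof. by rewrite sqr_sqrtr // ltW. Qed.
Let c1_gt0 : 0 < c1. Proof. by apply: le_lt_trans c2_lt. Qed.

Lemma dot_label_vector : dot z z = 1.
Proof.
rewrite /dot (eq_bigr (fun=> (n%:R)^-1)) => [|i _].
  by rewrite sumr_const card_ord -[LHS]mulr_natl divff // gt_eqF.
by rewrite /z mulrACA -expr2 s2 mul1r -expr2 exprVn rn2.
Qed.

Lemma dot_uniform_vector : dot o o = 1.
Proof.
rewrite /dot (eq_bigr (fun=> (n%:R)^-1)) => [|i _].
  by rewrite sumr_const card_ord -[LHS]mulr_natl divff // gt_eqF.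
by rewrite /uniform_vec -expr2 exprVn rn2.
Qed.

Lemma quad_mean x :
  dot x (mulmv N x) = l * (c2 * dot o x ^+ 2 + c1 * dot z x ^+ 2).
Proof.
rewrite dot_mulmv.
have -> : dot o x = rn^-1 * \sum_i x i by rewrite mulr_sumr.
have -> : dot z x = rn^-1 * \sum_i s i * x i.
  by rewrite mulr_sumr; apply: eq_bigr => i _; rewrite /label_vec; ring.
rewrite !exprMn !exprVn rn2 !expr2 !big_distrlr /= !mulrDr /=.
rewrite !mulr_sumr -big_split; apply: eq_bigr => i _ /=.
rewrite !mulr_sumr -big_split; apply: eq_bigr => j _ /=.
by rewrite /mean_mx; ring.
Qed.

Lemma unit_dot_le1 x y : dot x x = 1 -> dot y y = 1 -> dot x y ^+ 2 <= 1.
Proof. by move=> x1 y1; rewrite (le_trans (cauchy_schwarz x y)) // x1 y1 mulr1. Qed.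

Lemma dot_resid x y : dot y y = 1 ->
  let r i := x i - dot x y * y i in
  dot r y = 0 /\ dot r r = dot x x - dot x y ^+ 2.
Proof.
move=> y1 r; have re : r =1 (fun i => x i + - dot x y * y i).
  by move=> i; rewrite /r mulNr.
split.
  by rewrite (eq_dot re (fun=> erefl)) dotDl dotZl y1; ring.
rewrite (eq_dot re re) dotD2 dotZr !dotZl dotZr y1; ring.
Qed.

(** The sign of [c2] is unknown, but nearly balanced labels make [z] almost orthogonal to [o], so
    the [c2] term takes away at most [c1 * kap]. *)
Lemma top_quad_ge eps kap L : 0 <= eps -> quad_close (eps * l) L N ->
  `|dot o z| <= kap -> kap <= 1 ->
  l * (c1 - c1 * kap - eps) <= dot z (mulmv L z).
Proof.
move=> e0 cL oz k1.
have := cL z; rewrite ler_norml => /andP[+ _].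
rewrite quad_mean dot_label_vector expr1n mulr1 => h.
have k0 : 0 <= kap by apply: le_trans oz.
have h2 : dot o z ^+ 2 <= kap.
  rewrite -real_normK ?num_real // expr2; apply: le_trans (_ : kap * 1 <= _); last by rewrite mulr1.
  by apply: ler_pM => //; apply: le_trans k1.
have h3 : - (c1 * kap) <= c2 * dot o z ^+ 2.
  rewrite lerNl -mulNr; apply: le_trans (_ : c1 * dot o z ^+ 2 <= _).
    by rewrite ler_wpM2r ?sqr_ge0 // (le_trans _ (ltW c2_lt)) // -normrN ler_norm.
  by rewrite ler_wpM2l // ltW.
have : l * (- (c1 * kap)) <= l * (c2 * dot o z ^+ 2) by rewrite ler_pM2l.
lra.
Qed.

(** Mass of [u] on [z] is worth [c1], mass off [z] at most [|c2|], up to terms in [kap]. A vector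
    whose quotient reaches that of [z] thus pays [g] for each unit of mass off [z], out of the
    errors [eps] and [kap]. *)
Lemma top_vector_close eps kap L u : 0 <= eps -> quad_close (eps * l) L N ->
  `|dot o z| <= kap -> kap <= 1 -> dot u u = 1 ->
  dot z (mulmv L z) <= dot u (mulmv L u) ->
  g * (1 - dot u z ^+ 2) <= 2 * eps + 4 * c1 * kap.
Proof.
move=> e0 cL oz k1 u1 top.
have k0 : 0 <= kap by apply: le_trans oz.
have low := top_quad_ge e0 cL oz k1.
have := cL u; rewrite ler_norml => /andP[_].
rewrite quad_mean u1 mulr1 => up.
have [rz rr] := dot_resid u dot_label_vector.
move: rz rr; set r := (fun i => u i - _) => rz rr.
set rho := 1 - dot u z ^+ 2.
have rho0 : 0 <= rho by rewrite subr_ge0 (unit_dot_le1 u1 dot_label_vector).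
have rho1 : rho <= 1 by rewrite /rho lerBlDr lerDl sqr_ge0.
have our : dot o u = dot u z * dot o z + dot o r.
  rewrite (eq_dot (x' := o) (y' := fun i => dot u z * z i + r i)) //.
    by rewrite dotDr dotZr.
  by move=> i; rewrite /r addrC subrK.
have or2 : dot o r ^+ 2 <= rho.
  by apply: le_trans (cauchy_schwarz _ _) _; rewrite dot_uniform_vector mul1r rr u1.
have ab1 : `|dot u z * dot o z * dot o r| <= kap.
  have uz1 : `|dot u z| <= 1.
    by rewrite -(@expr_le1 _ 2%N) // real_normK ?num_real // (unit_dot_le1 u1 dot_label_vector).
  have or1 : `|dot o r| <= 1.
    by rewrite -(@expr_le1 _ 2%N) // real_normK ?num_real // (le_trans or2).
  rewrite !normrM; apply: le_trans (_ : _ <= 1 * kap * 1) _; last by rewrite mul1r mulr1.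
  by apply: ler_pM => //; apply: ler_pM.
have ab2 : (dot u z * dot o z) ^+ 2 <= kap.
  rewrite exprMn -[leRHS]mul1r; apply: ler_pM; rewrite ?sqr_ge0 //.
    exact: unit_dot_le1 u1 dot_label_vector.
  rewrite -real_normK ?num_real // expr2 -[leRHS]mulr1.
  by apply: ler_pM => //; apply: le_trans k1.
have ou2 : dot o u ^+ 2 <= 3 * kap + rho.
  rewrite our sqrrD; move: ab1; rewrite ler_norml => /andP[_ ab1]; lra.
have h3 : c2 * dot o u ^+ 2 <= `|c2| * (3 * kap + rho).
  apply: le_trans (_ : `|c2| * dot o u ^+ 2 <= _).
    by rewrite ler_wpM2r ?sqr_ge0 // ler_norm.
  by rewrite ler_wpM2l.
have zu : dot z u ^+ 2 = 1 - rho by rewrite dotC /rho; ring.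
rewrite zu in up.
have : l * (c1 - c1 * kap - eps) <= l * (`|c2| * (3 * kap + rho) + c1 * (1 - rho) + eps).
  apply: le_trans low _; apply: le_trans top _.
  rewrite lerBlDr in up; apply: le_trans up _.
  have : l * (c2 * dot o u ^+ 2) <= l * (`|c2| * (3 * kap + rho)) by rewrite ler_pM2l.
  lra.
rewrite ler_pM2l //.
have : `|c2| * kap <= c1 * kap by rewrite ler_wpM2r // ltW.
lra.
Qed.

(** Substitute for a bound on the second eigenvalue: a vector orthogonal to [v] sees [z] only
    through [z - <z,v> v], of squared norm at most [rho], so the large coefficient [c1] enters with
    weight [rho]. *)
Lemma quad_le_gap eps rho L v r : quad_close (eps * l) L N -> dot v v = 1 ->
  1 - dot v z ^+ 2 <= rho -> dot r v = 0 ->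
  dot r (mulmv L r) <= l * (`|c2| + c1 * rho + eps) * dot r r.
Proof.
move=> cL v1 vz rv.
have := cL r; rewrite ler_norml => /andP[_]; rewrite quad_mean => up.
have zr : dot z r ^+ 2 <= rho * dot r r.
  have [_] := dot_resid z v1; set w := (fun i => _) => ww.
  have -> : dot z r = dot w r.
    have we : w =1 (fun i => z i + - dot z v * v i) by move=> i; rewrite /w mulNr.
    by rewrite (eq_dot we (fun=> erefl)) dotDl dotZl (dotC v r) rv mulr0 addr0.
  apply: le_trans (cauchy_schwarz _ _) _; rewrite ler_wpM2r ?dot_ge0 //.
  by rewrite ww dot_label_vector dotC.
have or : dot o r ^+ 2 <= dot r r.
  by apply: le_trans (cauchy_schwarz _ _) _; rewrite dot_uniform_vector mul1r.
have h1 : c2 * dot o r ^+ 2 <= `|c2| * dot r r.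
  apply: le_trans (_ : `|c2| * dot o r ^+ 2 <= _).
    by rewrite ler_wpM2r ?sqr_ge0 // ler_norm.
  by rewrite ler_wpM2l.
have h2 : c1 * dot z r ^+ 2 <= c1 * (rho * dot r r) by rewrite ler_wpM2l // ltW.
have : l * (c2 * dot o r ^+ 2 + c1 * dot z r ^+ 2) <= l * (`|c2| * dot r r + c1 * (rho * dot r r)).
  by rewrite ler_pM2l // lerD.
lra.
Qed.

End RankTwoMean.

(** * Leave-one-out comparison *)

Lemma normr_le_sqr (R : realDomainType) (a b : R) :
  0 <= b -> a ^+ 2 <= b ^+ 2 -> `|a| <= b.
Proof.
by move=> b0; rewrite -(real_normK (num_real a)) ler_sqr ?nnegrE.
Qed.

Section LeaveOneOut.
Context {R : realType} {n : nat}.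
Implicit Types (x y u v r : 'I_n -> R) (L : 'I_n -> 'I_n -> R) (k : 'I_n).

Definition erase k L : 'I_n -> 'I_n -> R :=
  fun i j => if (i == k) || (j == k) then 0 else L i j.

(** The matrices differ in row and column [k] only, and the zero diagonal keeps the entry at [k, k]
    from counting twice. *)
Lemma dot_erase k L x y :
  (forall i j, L i j = L j i) -> (forall i, L i i = 0) ->
  dot y (mulmv L x) - dot y (mulmv (erase k L) x) =
  y k * mulmv L x k + x k * mulmv L y k.
Proof.
move=> sL L0; rewrite !dot_mulmv -sumrB (bigD1 k) //=; congr (_ + _).
  rewrite -sumrB /mulmv mulr_sumr; apply: eq_bigr => j _.
  by rewrite /erase eqxx /=; ring.
rewrite /mulmv mulr_sumr [RHS](bigD1 k) //= L0 mul0r mulr0 add0r.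
apply: eq_bigr => i ik; rewrite -sumrB (bigD1 k) //= big1 => [|j jk].
  by rewrite /erase eqxx orbT (sL k i); ring.
by rewrite /erase (negbTE ik) (negbTE jk) subrr.
Qed.

Lemma erase_sym k L : (forall i j, L i j = L j i) ->
  forall i j, erase k L i j = erase k L j i.
Proof. by move=> sL i j; rewrite /erase orbC sL. Qed.

(** Pairing the equation of [u] with the residual [r], which is orthogonal to [v], gives gp <r,r> <=
    u_k (lam r_k + (L r)_k). The factor [u k] comes out of both terms because (L u)_k = lam u_k, so
    the residual is proportional to the entry itself. *)
Lemma leave_one_out_close k L u v lam mu gp K :
  (forall i j, L i j = L j i) -> (forall i, L i i = 0) ->
  (forall x, mulmv L x k ^+ 2 <= K * dot x x) ->
  mulmv L u =1 (fun i => lam * u i) ->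
  mulmv (erase k L) v =1 (fun i => mu * v i) -> dot v v = 1 ->
  let r i := u i - dot u v * v i in
  0 < gp -> dot r (mulmv (erase k L) r) <= (lam - gp) * dot r r ->
  gp ^+ 2 * dot r r <= 2 * (lam ^+ 2 + K) * u k ^+ 2.
Proof.
move=> sL L0 LK Lu Lv v1 r gp0 gap.
have [rv _] := dot_resid u v1; rewrite -/r in rv.
have ur : u =1 (fun i => r i + dot u v * v i) by move=> i; rewrite /r subrK.
have ru : dot r u = dot r r.
  by rewrite (eq_dot (fun=> erefl) ur) dotDr dotZr rv mulr0 addr0.
have rLu : dot r (mulmv (erase k L) u) = dot r (mulmv (erase k L) r).
  rewrite (eq_dot (fun=> erefl) (eq_mulmv _ ur)).
  rewrite (eq_dot (fun=> erefl) (mulmvD _ _ _)) dotDr.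
  rewrite (eq_dot (fun=> erefl) (mulmvZ _ _ v)) dotZr.
  by rewrite (eq_dot (fun=> erefl) Lv) dotZr rv !mulr0 addr0.
have := dot_erase k u r sL L0.
rewrite rLu (eq_dot (fun=> erefl) Lu) dotZr ru Lu => key.
set X := lam * r k + mulmv L r k.
have h1 : gp * dot r r <= u k * X by rewrite /X; lra.
have h2 : X ^+ 2 <= 2 * (lam ^+ 2 + K) * dot r r.
  have a1 : 0 <= (lam * r k - mulmv L r k) ^+ 2 by apply: sqr_ge0.
  have a2 : lam ^+ 2 * r k ^+ 2 <= lam ^+ 2 * dot r r.
    by rewrite ler_wpM2l ?sqr_ge0 // le_dot.
  have := LK r; rewrite /X; nra.
have r0 := dot_ge0 r.
have [rz|rnz] := eqVneq (dot r r) 0.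
  rewrite rz mulr0 mulr_ge0 ?sqr_ge0 // mulr_ge0 // addr_ge0 ?sqr_ge0 //.
  have := LK (fun j => (j == k)%:R); rewrite dot_delta_l eqxx mulr1.
  by apply: le_trans; exact: sqr_ge0.
have rp : 0 < dot r r by rewrite lt_neqAle eq_sym rnz.
have : (gp * dot r r) ^+ 2 <= (u k * X) ^+ 2.
  have gd0 : 0 <= gp * dot r r by rewrite mulr_ge0 // ltW.
  by rewrite ler_sqr ?nnegrE // (le_trans gd0).
rewrite !exprMn => h3.
have h4 : u k ^+ 2 * X ^+ 2 <= u k ^+ 2 * (2 * (lam ^+ 2 + K) * dot r r).
  by rewrite ler_wpM2l // sqr_ge0.
rewrite -(ler_pM2r rp).
have -> : gp ^+ 2 * dot r r * dot r r = gp ^+ 2 * dot r r ^+ 2 by ring.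
apply: le_trans h3 _; apply: le_trans h4 _.
by rewrite le_eqVlt; apply/orP; left; apply/eqP; ring.
Qed.

(** A row has few and bounded entries, so its norm is only of order [sqrt l]. Against eigenvalues of
    order [l] this is negligible once [l] is large. *)
Lemma row_norm_bound k L V (B D l : R) x :
  (forall j, 0 <= V j <= 1) -> (forall j, `|L k j| <= B * V j) ->
  \sum_j V j <= D * l -> mulmv L x k ^+ 2 <= B ^+ 2 * (D * l) * dot x x.
Proof.
move=> V01 LV deg; apply: le_trans (cauchy_schwarz (L k) x) _.
rewrite ler_wpM2r ?dot_ge0 //.
apply: le_trans (_ : _ <= B ^+ 2 * \sum_j V j) _; last by rewrite ler_wpM2l ?sqr_ge0.
rewrite /dot mulr_sumr; apply: ler_sum => j _.
have /andP[V0 V1] := V01 j.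
rewrite -expr2 -real_normK ?num_real //; apply: le_trans (_ : (B * V j) ^+ 2 <= _).
  by rewrite ler_sqr ?nnegrE // (le_trans _ (LV j)).
rewrite exprMn ler_wpM2l ?sqr_ge0 // expr2 ler_piMl //.
Qed.

Lemma quad_close_erase k L N (K eps e : R) :
  (forall i j, L i j = L j i) -> (forall i, L i i = 0) ->
  (forall x, mulmv L x k ^+ 2 <= K * dot x x) -> 0 <= e -> 4 * K <= e ^+ 2 ->
  quad_close eps L N -> quad_close (eps + e) (erase k L) N.
Proof.
move=> sL L0 LK e0 Ke cL x.
have := dot_erase k x x sL L0; set a := dot x (mulmv L x); set b := dot x (mulmv _ x).
move=> ab.
have h : `|b - a| <= e * dot x x.
  have -> : b - a = - (2 * (x k * mulmv L x k)) by lra.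
  rewrite normrN; apply: normr_le_sqr; first by rewrite mulr_ge0 // dot_ge0.
  rewrite !exprMn.
  have h1 : x k ^+ 2 * mulmv L x k ^+ 2 <= dot x x * (K * dot x x).
    by apply: ler_pM; rewrite ?sqr_ge0 // le_dot.
  have h2 : 4 * K * (dot x x) ^+ 2 <= e ^+ 2 * (dot x x) ^+ 2.
    by rewrite ler_wpM2r // sqr_ge0.
  nra.
rewrite mulrDl; have := cL x; rewrite -/a => ha.
have -> : b - dot x (mulmv N x) = (a - dot x (mulmv N x)) + (b - a) by ring.
by apply: le_trans (ler_normD _ _) _; rewrite lerD.
Qed.

End LeaveOneOut.

(** The two spins cancel the arbitrary signs of the eigenvectors. The components along [z]
    contribute at least [(1 - rho) ^+ 2], the orthogonal ones at most [rho] in modulus, and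
    [1 - 3 * rho >= 1 / 2] is the origin of 1 / 6. *)
Lemma aligned_dot (R : realType) n (u v z : 'I_n -> R) (rho : R) :
  dot u u = 1 -> dot v v = 1 -> dot z z = 1 ->
  1 - dot u z ^+ 2 <= rho -> 1 - dot v z ^+ 2 <= rho -> rho <= 1 / 6 ->
  1 / 2 <= spin (dot u z < 0) * spin (dot v z < 0) * dot u v.
Proof.
move=> u1 v1 z1 uz vz r6.
have norm1 x : dot x x = 1 -> 1 - dot x z ^+ 2 <= rho -> 1 - rho <= `|dot x z|.
  move=> x1 xz; have := unit_dot_le1 x1 z1.
  rewrite -real_normK ?num_real // in xz *.
  rewrite expr_le1 // => h; apply: le_trans (_ : `|dot x z| ^+ 2 <= _); first lra.
  by rewrite expr2 ler_piMl.
have [_ ruu] := dot_resid u z1; have [rvz rvv] := dot_resid v z1.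
move: ruu rvz rvv; set ru := (fun i => u i - _); set rv := (fun i => v i - _).
move=> ruu rvz rvv.
have ue : u =1 (fun i => ru i + dot u z * z i) by move=> i; rewrite /ru subrK.
have ve : v =1 (fun i => rv i + dot v z * z i) by move=> i; rewrite /rv subrK.
have uv : dot u v = dot ru rv + dot u z * dot v z.
  rewrite {1}(eq_dot ue (fun=> erefl)) dotDl dotZl (dotC z v); congr (_ + _).
  have [ruz _] := dot_resid u z1.
  by rewrite (eq_dot (fun=> erefl) ve) dotDr dotZr ruz mulr0 addr0.
have rho0 : 0 <= rho.
  by apply: le_trans uz; rewrite subr_ge0 unit_dot_le1.
have small : `|dot ru rv| <= rho.
  apply: normr_le_sqr => //; apply: le_trans (cauchy_schwarz _ _) _.
  by rewrite expr2; apply: ler_pM; rewrite ?dot_ge0 // ?ruu ?rvv ?u1 ?v1.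
rewrite uv mulrDr mulrACA !spin_ltr0.
have := norm1 u u1 uz; have := norm1 v v1 vz.
set a := `|dot u z|; set b := `|dot v z| => hb ha.
have ab : (1 - rho) * (1 - rho) <= a * b by apply: ler_pM => //; lra.
have : `|spin (dot u z < 0) * spin (dot v z < 0) * dot ru rv| <= rho.
  by rewrite !normrM !normr_spin !mul1r.
rewrite ler_norml => /andP[h _].
have : 0 <= rho * rho by rewrite mulr_ge0.
lra.
Qed.

(** * Entrywise lower bound under deterministic hypotheses *)

Section Entrywise.
Context {R : realType} {n : nat}.
Variables (s : 'I_n -> R) (l c1 c2 B D : R) (L V : 'I_n -> 'I_n -> R).
Variables (eps kap rho : R).
Local Notation rn := (Num.sqrt n%:R : R).
Local Notation z := (label_vec s).
Local Notation N := (mean_mx s l c1 c2).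
Local Notation g := (c1 - `|c2|).
Hypothesis n0 : (0 < n)%N.
Hypothesis s2 : forall i, s i ^+ 2 = 1.
Hypothesis l1 : 1 <= l.
Hypothesis c2_lt : `|c2| < c1.
Hypothesis B0 : 0 <= B.
Hypothesis D0 : 0 <= D.
Hypothesis sL : forall i j, L i j = L j i.
Hypothesis L0 : forall i, L i i = 0.
Hypothesis V01 : forall i j, 0 <= V i j <= 1.
Hypothesis LV : forall i j, `|L i j| <= B * V i j.
Hypothesis deg : forall i, \sum_j V i j <= D * l.
Hypothesis eps0 : 0 <= eps.
Hypothesis cL : quad_close (eps * l) L N.
Hypothesis oz : `|dot uniform_vec z| <= kap.
Hypothesis eps_large : 4 * (B ^+ 2 * D) <= eps ^+ 2 * l.
Hypothesis eps_small : 4 * eps + 4 * c1 * kap <= g * rho.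
Hypothesis rho6 : rho <= 1 / 6.
Hypothesis rho_g : c1 * rho <= g / 4.

Let l0 : 0 < l. Proof. by apply: lt_le_trans l1. Qed.
Let g0 : 0 < g. Proof. by rewrite subr_gt0. Qed.
Let c1_gt0 : 0 < c1. Proof. by apply: le_lt_trans c2_lt. Qed.
Let gc1 : g <= c1. Proof. by rewrite gerBl. Qed.
Let kap0 : 0 <= kap. Proof. by apply: le_trans oz. Qed.
Let grho : g * rho <= g / 6.
Proof. by have := ler_wpM2l (ltW g0) rho6; lra. Qed.
Let c1kap0 : 0 <= c1 * kap. Proof. by rewrite mulr_ge0 // ltW. Qed.
Let kap1 : kap <= 1.
Proof. by rewrite -(ler_pM2l c1_gt0); move: grho gc1 c1_gt0 eps_small eps0; lra. Qed.

Let eps_le2 : eps <= 2 * eps. Proof. by rewrite mulr_natl mulr2n lerDl. Qed.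
Let eps2_ge0 : 0 <= 2 * eps. Proof. by rewrite mulr_ge0. Qed.

Lemma mulmv_entry_bound k x : mulmv L x k ^+ 2 <= B ^+ 2 * (D * l) * dot x x.
Proof. exact: row_norm_bound (V01 k) (LV k) (deg k). Qed.

Lemma quad_close_erased k : quad_close (2 * eps * l) (erase k L) N.
Proof.
have -> : 2 * eps * l = eps * l + eps * l by ring.
apply: (quad_close_erase sL L0 (mulmv_entry_bound k)) => //.
  by rewrite mulr_ge0 // ltW.
have -> : 4 * (B ^+ 2 * (D * l)) = 4 * (B ^+ 2 * D) * l by ring.
have -> : (eps * l) ^+ 2 = eps ^+ 2 * l * l by ring.
by rewrite ler_pM2r.
Qed.

(** Applied to [L] with [eps' = eps] and to the erased matrices with [eps' = 2 * eps]; [eps_small]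
    is calibrated for the latter. *)
Lemma top_close eps' L' u lam : 0 <= eps' -> eps' <= 2 * eps ->
  quad_close (eps' * l) L' N -> dot u u = 1 ->
  mulmv L' u =1 (fun i => lam * u i) ->
  (forall x, dot x (mulmv L' x) <= lam * dot x x) ->
  [/\ 1 - dot u z ^+ 2 <= rho, l * (c1 - c1 * kap - eps') <= lam & lam <= 3 * c1 * l].
Proof.
move: l0 g0 c1_gt0 gc1 kap0 grho c1kap0 eps0 eps_small rho6 rho_g =>
  ? ? ? ? ? ? ? ? ? ? ?.
move=> e0 e2 cL' u1 Lu uR.
have z1 := dot_label_vector n0 s2.
have lamE : dot u (mulmv L' u) = lam.
  by rewrite (eq_dot (fun=> erefl) Lu) dotZr u1 mulr1.
have zu : dot z (mulmv L' z) <= dot u (mulmv L' u).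
  by rewrite lamE; apply: le_trans (uR z) _; rewrite z1 mulr1.
have uz1 := unit_dot_le1 u1 z1.
split.
- have := top_vector_close n0 s2 l0 c2_lt e0 cL' oz kap1 u1 zu => h.
  by rewrite -(ler_pM2l g0); lra.
- by apply: le_trans (top_quad_ge n0 s2 l0 c2_lt e0 cL' oz kap1) _; rewrite -lamE.
- have := cL' u; rewrite lamE ler_norml => /andP[_].
  rewrite quad_mean // u1 mulr1 lerBlDr => h.
  apply: le_trans h _; rewrite (mulrC eps') -mulrDr (mulrC _ l) ler_pM2l //.
  have h1 : c2 * dot uniform_vec u ^+ 2 <= c1 * 1.
    apply: le_trans (_ : `|c2| * dot uniform_vec u ^+ 2 <= _).
      by rewrite ler_wpM2r ?sqr_ge0 // ler_norm.
    apply: ler_pM; rewrite ?sqr_ge0 // ?(ltW c2_lt) //.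
    exact: unit_dot_le1 (dot_uniform_vector n0) u1.
  have h2 : c1 * dot z u ^+ 2 <= c1 * 1.
    by rewrite ler_wpM2l ?(ltW c1_gt0) // dotC.
  lra.
Qed.

Variables (u : 'I_n -> R) (lam : R) (v : 'I_n -> 'I_n -> R) (mu : 'I_n -> R).
Hypothesis u1 : dot u u = 1.
Hypothesis Lu : mulmv L u =1 (fun i => lam * u i).
Hypothesis uR : forall x, dot x (mulmv L x) <= lam * dot x x.
Hypothesis v1 : forall k, dot (v k) (v k) = 1.
Hypothesis Lv : forall k, mulmv (erase k L) (v k) =1 (fun i => mu k * v k i).
Hypothesis vR : forall k x, dot x (mulmv (erase k L) x) <= mu k * dot x x.

(** [Cr] compares the leave-one-out residual with [u k], [C1] bounds the sup norm of [u] in units of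
    1 / sqrt n, [e] and [delta] measure what the residual and the deviation [w] contribute to an
    entry, and [mrg] is the margin of the signed row sums. *)
Variables (Cr C1 e delta mrg : R).
Hypothesis Cr1 : 1 <= Cr.
Hypothesis Cr_large : 8 * (9 * c1 ^+ 2 + B ^+ 2 * D) <= g ^+ 2 * Cr.

Local Notation resid k := (fun i => u i - dot u (v k) * v k i).

(** [leave_one_out_close] with the gap [l * (g / 2)]: [lam ^+ 2] and the squared gap are both of
    order [l ^+ 2], so [Cr] is free of [l]. *)
Lemma resid_small k : dot (resid k) (resid k) <= Cr ^+ 2 * u k ^+ 2.
Proof.
have [uz lamL lamU] := top_close eps0 eps_le2 cL u1 Lu uR.
have [vz _ _] := top_close eps2_ge0 (lexx _) (@quad_close_erased k) (v1 k) (Lv k) (vR k).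
have [rv _] := dot_resid u (v1 k).
have gp0 : 0 < l * (g / 2) by rewrite mulr_gt0 // divr_gt0.
have gap : dot (resid k) (mulmv (erase k L) (resid k)) <=
    (lam - l * (g / 2)) * dot (resid k) (resid k).
  apply: le_trans (quad_le_gap n0 s2 l0 c2_lt (@quad_close_erased k) (v1 k) vz rv) _.
  rewrite ler_wpM2r ?dot_ge0 //.
  have : l * (`|c2| + c1 * rho + 2 * eps) <= l * (c1 - c1 * kap - eps - g / 2).
    rewrite ler_pM2l //; move: grho c1kap0 eps0 eps_small rho_g g0; lra.
  by move: lamL; lra.
have := leave_one_out_close sL L0 (mulmv_entry_bound k) Lu (Lv k) (v1 k) gp0 gap.
set r2 := dot _ _ => h.
have lam0 : 0 <= lam.
  apply: le_trans lamL; rewrite mulr_ge0 ?(ltW l0) //.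
  by move: grho c1kap0 eps0 eps_small gc1 g0; lra.
have lam2 : lam ^+ 2 <= 9 * c1 ^+ 2 * l ^+ 2.
  have -> : 9 * c1 ^+ 2 * l ^+ 2 = (3 * c1 * l) ^+ 2 by ring.
  by rewrite ler_sqr ?nnegrE // (le_trans lam0).
have BD : B ^+ 2 * (D * l) <= B ^+ 2 * D * l ^+ 2.
  rewrite mulrA ler_wpM2l ?mulr_ge0 ?sqr_ge0 // expr2.
  by rewrite ler_peMl // ltW.
have u2 := sqr_ge0 (u k).
have h2 : (l * (g / 2)) ^+ 2 * r2 <= 2 * (9 * c1 ^+ 2 + B ^+ 2 * D) * l ^+ 2 * u k ^+ 2.
  by apply: le_trans h _; rewrite ler_wpM2r //; move: lam2 BD; lra.
have lg : 0 < l ^+ 2 * g ^+ 2 by rewrite mulr_gt0 // exprn_gt0.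
rewrite -(ler_pM2l lg).
apply: le_trans (_ : 8 * (9 * c1 ^+ 2 + B ^+ 2 * D) * (l ^+ 2 * u k ^+ 2) <= _).
  have -> : l ^+ 2 * g ^+ 2 * r2 = 4 * ((l * (g / 2)) ^+ 2 * r2) by field.
  by move: h2; lra.
apply: le_trans (_ : g ^+ 2 * Cr * (l ^+ 2 * u k ^+ 2) <= _).
  by rewrite ler_wpM2r // mulr_ge0 // sqr_ge0.
have -> : l ^+ 2 * g ^+ 2 * (Cr ^+ 2 * u k ^+ 2) = g ^+ 2 * Cr ^+ 2 * (l ^+ 2 * u k ^+ 2) by ring.
apply: ler_wpM2r; first by rewrite mulr_ge0 ?sqr_ge0.
apply: ler_wpM2l; first exact: sqr_ge0.
by rewrite expr2 ler_peMl // (le_trans _ Cr1).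
Qed.

Local Notation w k := (fun j => v k j - spin (dot (v k) z < 0) * z j).

Hypothesis delta01 : 0 <= delta <= 1.
Hypothesis delta_row : forall k m, 1 - dot (v k) z ^+ 2 <= rho ->
  (forall j, `|w k j| <= m) ->
  \sum_j V k j * `|w k j| <= delta * l * (m + rn^-1).
Hypothesis margin : forall i, mrg * l <= \sum_j s i * s j * L i j.
Hypothesis mrg_gt0 : 0 < mrg.
Hypothesis e0 : 0 < e.
Hypothesis e_large : B ^+ 2 * D * Cr ^+ 2 <= e ^+ 2 * l.
Hypothesis e_g : e <= g / 8.
Hypothesis e_C1 : e * C1 <= mrg / 8.
Hypothesis C1_large : B * (D + 2) * 4 <= g * C1.
Hypothesis delta_g : 2 * B * delta * (1 + Cr) <= g / 8.
Hypothesis delta_C1 : B * delta * (2 * (1 + Cr) * C1 + 2) <= mrg / 8.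

Let sgn k := spin (dot u z < 0) * spin (dot (v k) z < 0) : R.

(* The entry [lam * u k = (L u) k] is split according to
   [u = resid + <u, v> v], with [v] itself split into its label component and [w]. *)
Lemma entry_split k : exists a b : R,
  [/\ lam * u k = a + b + dot u (v k) * spin (dot (v k) z < 0) *
        (s k * \sum_j s k * s j * L k j) / rn,
      `|a| <= e * l * `|u k| &
      forall U, (forall j, `|u j| <= U) ->
        `|b| <= B * delta * l * (2 * (1 + Cr) * U + 2 / rn)].
Proof.
set S := spin (dot (v k) z < 0).
have z1 := dot_label_vector n0 s2.
have rn0 : 0 < rn by rewrite sqrtr_gt0 ltr0n.
exists (mulmv L (resid k) k), (dot u (v k) * mulmv L (w k) k); split.
- rewrite -Lu.
  have ue : u =1 (fun i => resid k i + dot u (v k) * (w k i + S * z i)).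
    by move=> i; rewrite (subrK (S * z i)) subrK.
  rewrite (eq_mulmv _ ue).
  rewrite (mulmvD L (resid k) (fun i => dot u (v k) * (w k i + S * z i))).
  rewrite (mulmvZ L _ (fun i => w k i + S * z i)) (mulmvD L (w k) (fun i => S * z i)).
  rewrite (mulmvZ L S z) mulrDr addrA.
  congr (_ + _); rewrite -!mulrA; congr (_ * _); congr (_ * _).
  rewrite mulrA mulr_sumr mulr_suml; apply: eq_bigr => j _.
  have := s2 k; rewrite expr2 /label_vec => sk.
  transitivity (s k * s k * (L k j * (s j / rn))); first by rewrite sk mul1r.
  by ring.
- apply: normr_le_sqr; first by rewrite !mulr_ge0 // ltW.
  apply: le_trans (mulmv_entry_bound k _) _.
  have h := resid_small k.
  apply: le_trans (_ : B ^+ 2 * (D * l) * (Cr ^+ 2 * u k ^+ 2) <= _).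
    by rewrite ler_wpM2l // !mulr_ge0 ?sqr_ge0 // ltW.
  rewrite 2!exprMn real_normK ?num_real //.
  have -> : B ^+ 2 * (D * l) * (Cr ^+ 2 * u k ^+ 2) = B ^+ 2 * D * Cr ^+ 2 * (l * u k ^+ 2) by ring.
  have -> : e ^+ 2 * l ^+ 2 * u k ^+ 2 = e ^+ 2 * l * (l * u k ^+ 2) by ring.
  by rewrite ler_wpM2r // mulr_ge0 ?sqr_ge0 // ltW.
- move=> U uU.
  have [uz _ _] := top_close eps0 eps_le2 cL u1 Lu uR.
  have [vz _ _] := top_close eps2_ge0 (lexx _) (@quad_close_erased k) (v1 k) (Lv k) (vR k).
  have al := aligned_dot u1 (v1 k) z1 uz vz rho6.
  have rho2 : 1 / 2 <= `|dot u (v k)|.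
    by apply: le_trans al _; apply: le_trans (ler_norm _) _; rewrite !normrM !normr_spin !mul1r.
  have r1 : `|dot u (v k)| <= 1.
    by apply: normr_le_sqr => //; rewrite expr1n unit_dot_le1.
  have rj j : `|resid k j| <= Cr * U.
    apply: normr_le_sqr; first by rewrite mulr_ge0 // ?(le_trans _ Cr1) // (le_trans _ (uU k)).
    apply: le_trans (le_dot (resid k) j) _; apply: le_trans (resid_small k) _.
    rewrite exprMn ler_wpM2l ?sqr_ge0 // -real_normK ?num_real //.
    by rewrite ler_sqr ?nnegrE // (le_trans _ (uU k)).
  (* The sup norm of [v k] is controlled by that of [u], by solving [u = resid + <u,v> v] for [v]:
     the coefficient is at least 1 / 2 in modulus. *)
  have vj j : `|v k j| <= 2 * (1 + Cr) * U.
    have : `|dot u (v k)| * `|v k j| <= (1 + Cr) * U.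
      rewrite -normrM; have -> : dot u (v k) * v k j = u j - resid k j by ring.
      by apply: le_trans (ler_normB _ _) _; rewrite mulrDl mul1r lerD.
    have : 1 / 2 * `|v k j| <= `|dot u (v k)| * `|v k j| by rewrite ler_wpM2r.
    by lra.
  have wj j : `|w k j| <= 2 * (1 + Cr) * U + rn^-1.
    apply: le_trans (ler_normB _ _) _; rewrite lerD //.
    rewrite normrM normr_spin mul1r /label_vec normrM [`|rn^-1|]gtr0_norm ?invr_gt0 //.
    have -> : `|s j| = 1; last by rewrite mul1r.
    by apply/eqP; rewrite -sqr_norm_eq1 s2.
  have := delta_row vz wj => h.
  rewrite normrM; apply: le_trans (_ : 1 * (B * (delta * l * (2 * (1 + Cr) * U + rn^-1 + rn^-1))) <= _).
    apply: ler_pM => //; apply: le_trans (_ : B * \sum_j V k j * `|w k j| <= _).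
      apply: le_trans (ler_norm_sum _ _ _) _; rewrite mulr_sumr.
      by apply: ler_sum => j _; rewrite normrM mulrA ler_wpM2r.
    by rewrite ler_wpM2l.
  by rewrite le_eqVlt; apply/orP; left; apply/eqP; ring.
Qed.

(** The main term is at least [mrg * l / 2], the errors at most [mrg * l / 4], and
    [lam <= 3 * c1 * l]; this makes the constant 12. *)
Theorem entrywise_lower_bound k :
  mrg / (12 * c1) <= rn * (spin (dot u z < 0) * s k * u k).
Proof.
have z1 := dot_label_vector n0 s2.
have rn0 : 0 < rn by rewrite sqrtr_gt0 ltr0n.
have [uz lamL lamU] := top_close eps0 eps_le2 cL u1 Lu uR.
have lamg : l * (g / 2) <= lam.
  apply: le_trans lamL; rewrite ler_pM2l //.
  by move: grho c1kap0 eps0 eps_small gc1 g0; lra.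
have lam0 : 0 < lam by apply: lt_le_trans lamg; rewrite mulr_gt0 // divr_gt0.
have Zup i : `|\sum_j s i * s j * L i j| <= B * D * l.
  apply: le_trans (ler_norm_sum _ _ _) _.
  apply: le_trans (_ : B * \sum_j V i j <= _); last first.
    by rewrite -mulrA ler_wpM2l.
  rewrite mulr_sumr; apply: ler_sum => j _.
  have s1 i' : `|s i'| = 1.
    by apply/eqP; rewrite -sqr_norm_eq1 s2.
  by rewrite !normrM !s1 !mul1r.
have s1 i' : `|s i'| = 1.
  by apply/eqP; rewrite -sqr_norm_eq1 s2.
have [k0 _ kmax] := @arg_maxP _ _ _ k predT (fun i => `|u i|) isT.
set U := `|u k0| in kmax.
have uU j : `|u j| <= U by apply: kmax.
have U0 : 0 <= U by apply: normr_ge0.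
(* Self-bounding at the largest entry: each error is a small multiple of [l * U], absorbed by
   [lam >= l * g / 2], or of order [l / rn]. *)
have UC : U * rn <= C1.
  have [a [b [eq ha hb]]] := entry_split k0.
  have {}hb := hb U uU.
  have h3 : `|dot u (v k0) * spin (dot (v k0) z < 0) *
        (s k0 * \sum_j s k0 * s j * L k0 j) / rn| <= B * D * l / rn.
    rewrite !normrM normr_spin s1 mulr1 mul1r [`|rn^-1|]gtr0_norm ?invr_gt0 //.
    rewrite ler_wpM2r ?invr_ge0 ?(ltW rn0) // -[leRHS]mul1r.
    apply: ler_pM => //; apply: normr_le_sqr => //.
    by rewrite expr1n unit_dot_le1.
  have : lam * U <= e * l * U + B * delta * l * (2 * (1 + Cr) * U + 2 / rn) + B * D * l / rn.
    rewrite /U -[X in X * _]gtr0_norm // -normrM eq.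
    apply: le_trans (ler_normD _ _) _; rewrite lerD //.
    by apply: le_trans (ler_normD _ _) _; rewrite lerD.
  have : l * (g / 2) * U <= lam * U by rewrite ler_wpM2r.
  have h4 : l * (e * U) <= l * (g / 8 * U) by rewrite ler_pM2l // ler_wpM2r.
  have h5 : l * (2 * B * delta * (1 + Cr) * U) <= l * (g / 8 * U) by rewrite ler_pM2l // ler_wpM2r.
  have h6 : B * delta * l * (2 / rn) <= B * 1 * l * (2 / rn).
    rewrite ler_wpM2r ?divr_ge0 ?(ltW rn0) // ler_wpM2r ?(ltW l0) // ler_wpM2l //.
    by case/andP: delta01.
  move=> h7 h8.
  have h9 : l * (g * U) <= l * (4 * B * (D + 2) / rn).
    by move: h4 h5 h6 h7 h8; lra.
  rewrite ler_pM2l // in h9.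
  rewrite -(ler_pM2l g0); apply: le_trans C1_large; rewrite mulrA.
  by rewrite -ler_pdivlMr // (le_trans h9) // le_eqVlt; apply/orP; left; apply/eqP; ring.
have [a [b [eq ha hb]]] := entry_split k.
have {}hb := hb U uU.
set S := spin (dot u z < 0) : R.
have S1 : `|S| = 1 by rewrite normr_spin.
have [vz _ _] := top_close eps2_ge0 (lexx _) (@quad_close_erased k) (v1 k) (Lv k) (vR k).
have al := aligned_dot u1 (v1 k) z1 uz vz rho6.
set Z := \sum_j s k * s j * L k j in eq.
have Zl : mrg * l <= Z by apply: margin.
have Z0 : 0 <= Z by apply: le_trans Zl; rewrite mulr_ge0 // ltW.
have main : 1 / 2 * (mrg * l) <= S * spin (dot (v k) z < 0) * dot u (v k) * Z.
  have h1 : 0 <= mrg * l by rewrite mulr_ge0 // ltW.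
  have h2 : 0 <= 1 / 2 :> R by rewrite divr_ge0.
  exact: ler_pM.
have key : lam * (rn * (S * s k * u k)) = rn * (S * s k * (a + b)) +
   S * spin (dot (v k) z < 0) * dot u (v k) * Z.
  have -> : lam * (rn * (S * s k * u k)) = rn * (S * s k) * (lam * u k) by ring.
  rewrite eq.
  have sk := s2 k.
  transitivity (rn * (S * s k * (a + b)) + s k ^+ 2 * (rn / rn) * (S * spin (dot (v k) z < 0) * dot u (v k) * Z)).
    by ring.
  by rewrite sk divff ?gt_eqF // !mul1r.
have err : `|rn * (S * s k * (a + b))| <= l * (mrg / 4).
  rewrite !normrM S1 s1 !mul1r [`|rn|]gtr0_norm //.
  apply: le_trans (_ : rn * (e * l * U + B * delta * l * (2 * (1 + Cr) * U + 2 / rn)) <= _).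
    rewrite ler_pM2l //; apply: le_trans (ler_normD _ _) _; rewrite lerD //.
    by apply: le_trans ha _; rewrite ler_wpM2l // mulr_ge0 // ltW.
  have -> : rn * (e * l * U + B * delta * l * (2 * (1 + Cr) * U + 2 / rn)) =
    l * (e * (U * rn) + B * delta * (2 * (1 + Cr) * (U * rn) + 2)) by field; rewrite gt_eqF.
  rewrite ler_pM2l //.
  have h1 : e * (U * rn) <= e * C1 by rewrite ler_pM2l.
  have h2 : B * delta * (2 * (1 + Cr) * (U * rn) + 2) <= B * delta * (2 * (1 + Cr) * C1 + 2).
    have d0 : 0 <= delta by case/andP: delta01.
    by rewrite ler_wpM2l ?mulr_ge0 // lerD2r ler_wpM2l // mulr_ge0 // addr_ge0 // (le_trans _ Cr1).
  by move: h1 h2 e_C1 delta_C1; lra.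
have fin : l * (mrg / 4) <= lam * (rn * (S * s k * u k)).
  rewrite key; move: err; rewrite ler_norml => /andP[err _].
  by move: err main; lra.
set X := rn * _ in fin *.
have X0 : 0 <= X.
  rewrite -(pmulr_rge0 _ lam0); apply: le_trans fin.
  by rewrite mulr_ge0 // ?(ltW l0) // divr_ge0 // ltW.
have h : l * (mrg / 4) <= 3 * c1 * l * X.
  by apply: le_trans fin _; rewrite ler_wpM2r.
have {}h : l * (mrg / 4) <= l * (3 * c1 * X) by move: h; lra.
rewrite ler_pM2l // in h.
by rewrite ler_pdivrMr ?mulr_gt0 //; move: h; lra.
Qed.

End Entrywise.

Lemma quad_bound_homogeneous (R : realType) n (W : 'I_n -> 'I_n -> R) (Q : R) :
  (forall x, dot x x = 1 -> `|dot x (mulmv W x)| <= Q) ->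
  forall x, `|dot x (mulmv W x)| <= Q * dot x x.
Proof.
move=> WQ x; have [x0|xn0] := eqVneq (dot x x) 0.
  have e := dot_eq0 x0; rewrite x0 mulr0 (eq_dot e (fun=> erefl)).
  by rewrite /dot big1 ?normr0 // => i _; rewrite mul0r.
have xp : 0 < dot x x by rewrite lt_neqAle eq_sym xn0 dot_ge0.
set t := Num.sqrt (dot x x).
have tp : 0 < t by rewrite sqrtr_gt0.
have tt : t ^+ 2 = dot x x by rewrite sqr_sqrtr // ltW.
have := WQ (fun i => t^-1 * x i).
rewrite mulmv_quadZ dotZl dotZr -tt mulrA -expr2 -exprMn mulVf ?gt_eqF //.
rewrite expr1n => /(_ erefl); rewrite exprVn normrM normfV.
by rewrite (gtr0_norm (exprn_gt0 2 tp)) mulrC ler_pdivrMr // exprn_gt0.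
Qed.

(** * The good events and the choice of constants *)

Section GoodEvents.
Context {R : realType}.

Definition sparse_on_small n (V : 'I_n -> 'I_n -> R) (d e l : R) : Prop :=
  forall T : {set 'I_n}, #|T|%:R <= d ^+ 2 * n%:R ->
    \sum_(i in T) \sum_(j in T) V i j <= e ^+ 2 * l * #|T|%:R.

Definition cut_bounded n (W : 'I_n -> 'I_n -> R) (d e l : R) : Prop :=
  forall s r : 'I_n -> bool,
    \sum_i \sum_j spin (s i) * spin (r j) * W i j <= e ^+ 3 * d ^+ 2 * (n%:R * l).

Definition top_pair n (L : 'I_n -> 'I_n -> R) (u : 'I_n -> R) (lam : R) : Prop :=
  [/\ dot u u = 1, mulmv L u =1 (fun i => lam * u i) &
      forall x, dot x (mulmv L x) <= lam * dot x x].

(** The premise restricts the bound to [v] close to the label vector, which the other events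
    guarantee. The term 1 / sqrt n beside [m] sets a smallest scale for the deviation: without it,
    the normalized deviation could have large entries in all coordinates even when [v] is very close
    to the label vector. *)
Definition row_mass_bounded n (V : 'I_n -> 'I_n -> R) (z : 'I_n -> R)
    (delta rho l : R) (k : 'I_n) (v : 'I_n -> R) : Prop :=
  let w j := v j - spin (dot v z < 0) * z j in
  1 - dot v z ^+ 2 <= rho -> forall m, (forall j, `|w j| <= m) ->
  \sum_j V k j * `|w j| <= delta * l * (m + (Num.sqrt n%:R)^-1).

End GoodEvents.

(** The order of quantifiers reflects how the probabilistic bounds depend on each other. The row
    bound with error [delta] needs an l^2 distance small in terms of [delta], so [rho0] is supplied
    after [delta]; the quadratic form error [e] depends on [rho]; and [d] stays free, because
    sparsity with density [e] holds only on sets that are small in terms of [e]. *)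
Theorem deterministic_bound (R : realType) (c1 c2 B D margin : R) :
  `|c2| < c1 -> 0 <= B -> 0 <= D -> 0 < margin -> exists eta delta : R,
  [/\ 0 < eta, 0 < delta & forall rho0, 0 < rho0 ->
  exists rho e kap l0 : R, [/\ 0 < rho <= rho0, 0 < e <= 1, 0 < kap, 0 < l0 &
  forall n (s : 'I_n -> R) l d (L V : 'I_n -> 'I_n -> R) u lam v mu,
  (0 < n)%N -> (forall i, s i ^+ 2 = 1) -> l0 <= l -> 0 < d <= 1 ->
  (forall i j, L i j = L j i) -> (forall i, L i i = 0) ->
  (forall i j, V i j = V j i) -> (forall i j, 0 <= V i j <= 1) ->
  (forall i j, `|L i j| <= B * V i j) ->
  (forall i, \sum_j V i j <= D * l) ->
  sparse_on_small V d e l ->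
  cut_bounded (fun i j => L i j - mean_mx s l c1 c2 i j) d e l ->
  `|dot uniform_vec (label_vec s)| <= kap ->
  top_pair L u lam -> (forall k, top_pair (erase k L) (v k) (mu k)) ->
  (forall k, row_mass_bounded V (label_vec s) delta rho l k (v k)) ->
  (forall i, margin * l <= \sum_j s i * s j * L i j) ->
  forall k, eta <= Num.sqrt n%:R * (spin (dot u (label_vec s) < 0) * s k * u k)]].
Proof.
move=> cc B0 D0 m0.
set g := c1 - `|c2|.
have g0 : 0 < g by rewrite subr_gt0.
have c10 : 0 < c1 by apply: le_lt_trans cc.
have gc : g <= c1 by rewrite gerBl.
pose BD := 8 * (9 * c1 ^+ 2 + B ^+ 2 * D).
have BD0 : 0 <= BD by rewrite mulr_ge0 // addr_ge0 // mulr_ge0 // sqr_ge0.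
have g2 : 0 < g ^+ 2 by rewrite exprn_gt0.
pose Cr := 1 + BD / g ^+ 2.
have Cr1 : 1 <= Cr by rewrite lerDl divr_ge0 // ltW.
have CrL : BD <= g ^+ 2 * Cr.
  by rewrite /Cr mulrDr mulr1 mulrCA divff ?gt_eqF // mulr1 lerDr ltW.
pose C1 := B * (D + 2) * 4 / g.
have C10 : 0 <= C1 by rewrite divr_ge0 ?(ltW g0) // !mulr_ge0 // addr_ge0.
have C1L : B * (D + 2) * 4 <= g * C1 by rewrite [g * C1]mulrC /C1 divfK ?gt_eqF.
pose a1 := 2 * B * (1 + Cr).
have a10 : 0 <= a1 by rewrite !mulr_ge0 // addr_ge0 // (le_trans _ Cr1).
pose a2 := B * (2 * (1 + Cr) * C1 + 2).
have a20 : 0 <= a2.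
  have : 0 <= (1 + Cr) * C1 by rewrite mulr_ge0 // addr_ge0 // (le_trans _ Cr1).
  by move=> h; rewrite mulr_ge0 //; lra.
pose delta := Num.min 1 (Num.min (g / (8 * (a1 + 1))) (margin / (8 * (a2 + 1)))).
have delta0 : 0 < delta.
  by rewrite !lt_min ltr01 !divr_gt0 // mulr_gt0 //; lra.
have delta1 : delta <= 1 by rewrite ge_min lexx.
have deltaa1 : delta * a1 <= g / 8.
  apply: le_trans (_ : g / (8 * (a1 + 1)) * (a1 + 1) <= _).
    apply: ler_pM; rewrite ?(ltW delta0) //; last by rewrite lerDl.
    by rewrite !ge_min lexx orbT.
  by rewrite le_eqVlt; apply/orP; left; apply/eqP; field; lra.
have deltaa2 : delta * a2 <= margin / 8.
  apply: le_trans (_ : margin / (8 * (a2 + 1)) * (a2 + 1) <= _).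
    apply: ler_pM; rewrite ?(ltW delta0) //; last by rewrite lerDl.
    by rewrite !ge_min lexx !orbT.
  by rewrite le_eqVlt; apply/orP; left; apply/eqP; field; lra.
pose f := Num.min (g / 8) (margin / (8 * (C1 + 1))).
have f0 : 0 < f by rewrite lt_min !divr_gt0 // mulr_gt0 //; lra.
have fg : f <= g / 8 by rewrite ge_min lexx.
have fC : f * C1 <= margin / 8.
  apply: le_trans (_ : margin / (8 * (C1 + 1)) * (C1 + 1) <= _).
    apply: ler_pM; rewrite ?(ltW f0) //; last by rewrite lerDl.
    by rewrite !ge_min lexx orbT.
  by rewrite le_eqVlt; apply/orP; left; apply/eqP; field; lra.
exists (margin / (12 * c1)), delta; split=> //; first by rewrite divr_gt0 // mulr_gt0.
move=> rho0 rho00.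
pose rho := Num.min rho0 (Num.min (1 / 6) (g / (4 * c1))).
have rhop : 0 < rho by rewrite !lt_min rho00 !divr_gt0 // mulr_gt0.
have rho6 : rho <= 1 / 6 by rewrite !ge_min lexx orbT.
have rhog : c1 * rho <= g / 4.
  apply: le_trans (_ : c1 * (g / (4 * c1)) <= _).
    by rewrite ler_pM2l // !ge_min lexx !orbT.
  by rewrite le_eqVlt; apply/orP; left; apply/eqP; field; lra.
(* The constant of [quad_bound_unit] with [C = 2 * c1], a bound for the entries of the mean in units
   of [l / n]. *)
pose K := 1 + 2 * (2 * c1) + B * (3 * D + 1).
have K0 : 0 < K.
  have : 0 <= B * (3 * D + 1) by rewrite mulr_ge0 // addr_ge0 // mulr_ge0.
  by rewrite /K; lra.
have grho : 0 < g * rho by rewrite mulr_gt0.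
pose e := Num.min 1 (g * rho / (8 * K)).
have e0 : 0 < e by rewrite lt_min ltr01 divr_gt0 // mulr_gt0.
have e1 : e <= 1 by rewrite ge_min lexx.
pose eps := e * K.
have eps0 : 0 < eps by rewrite mulr_gt0.
have epsU : eps <= g * rho / 8.
  apply: le_trans (_ : g * rho / (8 * K) * K <= _).
    by rewrite ler_pM2r // !ge_min lexx orbT.
  by rewrite le_eqVlt; apply/orP; left; apply/eqP; field; lra.
pose kap := g * rho / (8 * c1).
have kap0 : 0 < kap by rewrite divr_gt0 // mulr_gt0.
have kapE : c1 * kap = g * rho / 8 by rewrite /kap; field; rewrite gt_eqF.
pose l0 := 1 + 4 * (B ^+ 2 * D) / eps ^+ 2 + B ^+ 2 * D * Cr ^+ 2 / f ^+ 2.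
have B2D : 0 <= B ^+ 2 * D by rewrite mulr_ge0 ?sqr_ge0.
have t1 : 0 <= 4 * (B ^+ 2 * D) / eps ^+ 2 by rewrite divr_ge0 ?sqr_ge0 // mulr_ge0.
have t2 : 0 <= B ^+ 2 * D * Cr ^+ 2 / f ^+ 2.
  by rewrite divr_ge0 ?sqr_ge0 // mulr_ge0 // sqr_ge0.
exists rho, e, kap, l0; split; rewrite ?rhop ?e0 ?e1 ?ge_min ?lexx //.
  by move: t1 t2; rewrite /l0; clear; lra.
move=> n s l d L V u lam v mu n0 s2 ll d01 sL L0 sV V01 LV deg sparse cut bal top topv
  row marg.
have l1 : 1 <= l by apply: le_trans ll; move: t1 t2; rewrite /l0; clear; lra.
have l_0 : 0 < l := lt_le_trans ltr01 l1.
have nR : 0 < n%:R :> R by rewrite ltr0n.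
have cL : quad_close (eps * l) L (mean_mx s l c1 c2).
  pose W i j := L i j - mean_mx s l c1 c2 i j.
  have WE x : dot x (mulmv L x) - dot x (mulmv (mean_mx s l c1 c2) x) = dot x (mulmv W x).
    rewrite !dot_mulmv -sumrB; apply: eq_bigr => i _; rewrite -sumrB.
    by apply: eq_bigr => j _; rewrite /W; ring.
  move=> x; rewrite WE; move: x; apply: quad_bound_homogeneous => x x1.
  apply: (quad_bound_unit (V := V) (d := d)) => //.
  - by rewrite e0 e1.
  - exact: ltW.
  - by rewrite mulr_ge0 // ltW.
  - by move=> i j; case/andP: (V01 i j).
  - move=> i j; apply: le_trans (ler_normB _ _) _; rewrite lerD //.
    have s1 i' : `|s i'| = 1.
      by apply/eqP; rewrite -sqr_norm_eq1 s2.
    rewrite /mean_mx normrM [`|l / _|]gtr0_norm ?divr_gt0 // mulrC.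
    rewrite ler_wpM2r ?divr_ge0 ?(ltW l_0) //.
    apply: le_trans (ler_normD _ _) _; rewrite !normrM !s1 !mulr1 (gtr0_norm c10).
    by move: (ltW cc); clear; lra.
have [u1 Lu uR] := top.
apply: (entrywise_lower_bound n0 s2 l1 cc B0 D0 sL L0 V01 LV deg (ltW eps0) cL bal
  (rho := rho) _ _ rho6 rhog u1 Lu uR (v := v) (mu := mu) _ _ _ Cr1 CrL (delta := delta)
  _ _ marg m0 f0 _ fg fC C1L).
- rewrite -ler_pdivrMl ?exprn_gt0 // mulrC; apply: le_trans ll.
  by move: t1 t2; rewrite /l0; clear; lra.
- by rewrite -mulrA kapE -/g; move: epsU; clear; lra.
- by move=> k; case: (topv k).
- by move=> k; case: (topv k).
- by move=> k; case: (topv k).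
- by rewrite (ltW delta0).
- by move=> k m rk wm; apply: row.
- rewrite -ler_pdivrMl ?exprn_gt0 // mulrC; apply: le_trans ll.
  by move: t1 t2; rewrite /l0; clear; lra.
- by rewrite -/g; apply: le_trans deltaa1; rewrite /a1 le_eqVlt; apply/orP; left; apply/eqP; ring.
- by apply: le_trans deltaa2; rewrite /a2 le_eqVlt; apply/orP; left; apply/eqP; ring.
Qed.

(** * Exponential moments of the censored model *)

Section Pairs.
Context {R : realType} {n : nat}.
Implicit Types (f : vpair n -> R) (c : 'I_n -> 'I_n -> R) (e : vpair n).

Definition pairval f (i j : 'I_n) : R :=
  if insub [set i; j]%SET is Some e then f e else 0.

(** The adjoint of [pairval]: it turns a double sum over indices into a sum over independent pairs,
    with weight [c a b + c b a] on the pair of [a] and [b]. *)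
Definition pair_coef c e : R :=
  \sum_i \sum_j (val e == [set i; j]%SET)%:R * c i j.

Lemma pairvalE f i j :
  pairval f i j = \sum_e (val e == [set i; j]%SET)%:R * f e.
Proof.
rewrite /pairval; case: insubP => [e _ ev|nij].
  rewrite (bigD1 e) //= ev eqxx mul1r big1 ?addr0 // => e' ne.
  by rewrite -ev val_eqE (negbTE ne) mul0r.
rewrite big1 // => e _; case: eqP => [ev|]; last by rewrite mul0r.
by case/negP: nij; rewrite -ev; apply: (valP e).
Qed.

Lemma pairval_sym f i j : pairval f i j = pairval f j i.
Proof. by rewrite /pairval finset.setUC. Qed.

Lemma pairval_diag f i : pairval f i i = 0.
Proof. by rewrite /pairval; case: insubP => // e + _; rewrite finset.setUid cards1. Qed.

Lemma pair_sum f c :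
  \sum_i \sum_j pairval f i j * c i j = \sum_e f e * pair_coef c e.
Proof.
transitivity (\sum_i \sum_j \sum_e f e * ((val e == [set i; j]%SET)%:R * c i j)).
  apply: eq_bigr => i _; apply: eq_bigr => j _.
  by rewrite pairvalE mulr_suml; apply: eq_bigr => e _; rewrite mulrAC mulrC.
under eq_bigr do rewrite exchange_big.
rewrite exchange_big; apply: eq_bigr => e _.
by rewrite mulr_sumr; apply: eq_bigr => i _; rewrite mulr_sumr.
Qed.

Lemma vpairP e : exists a b : 'I_n, a != b /\ val e = [set a; b]%SET.
Proof. by have /cards2P[a [b [ab ->]]] := valP e; exists a, b. Qed.

Lemma eq_set2 (a b i j : 'I_n) : a != b ->
  ([set a; b]%SET == [set i; j]%SET) =
  ((i == a) && (j == b)) || ((i == b) && (j == a)).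
Proof.
move=> ab; apply/eqP/idP => [E|]; last first.
  by case/orP => /andP[/eqP-> /eqP->] //; rewrite finset.setUC.
have : i \in [set a; b]%SET by rewrite E !inE eqxx.
have : j \in [set a; b]%SET by rewrite E !inE eqxx orbT.
have : a \in [set i; j]%SET by rewrite -E !inE eqxx.
have : b \in [set i; j]%SET by rewrite -E !inE eqxx orbT.
rewrite !inE (eq_sym b i) (eq_sym b j) (eq_sym a i) (eq_sym a j).
have [->|ia] := eqVneq i a; have [->|ja] := eqVneq j a; rewrite ?(negbTE ab) //=.
by case: (i == b); case: (j == b).
Qed.

Lemma pair_coef2 c e a b : a != b -> val e = [set a; b]%SET ->
  pair_coef c e = c a b + c b a.
Proof.
move=> ab ev; have ba : b != a by rewrite eq_sym.
rewrite /pair_coef ev; under eq_bigr do under eq_bigr do rewrite (eq_set2 _ _ ab).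
rewrite (bigD1 a) //=; congr (_ + _).
  rewrite (bigD1 b) //= !eqxx /= mulr1n mul1r big1 ?addr0 // => j jb.
  by rewrite (negbTE jb) (negbTE ab) mul0r.
rewrite (bigD1 b) //= addrC big1 ?add0r => [|i /andP[ia ib]].
  rewrite (bigD1 a) //= !eqxx orbT mulr1n mul1r big1 ?addr0 // => j ja.
  by rewrite (negbTE ja) (negbTE ba) mul0r.
by rewrite big1 // => j _; rewrite (negbTE ia) (negbTE ib) mul0r.
Qed.

Lemma sum_pair_coef c : \sum_e pair_coef c e = \sum_i \sum_(j | j != i) c i j.
Proof.
rewrite (eq_bigr (fun e => 1 * pair_coef c e)) => [|e _]; last by rewrite mul1r.
rewrite -pair_sum; apply: eq_bigr => i _; rewrite [RHS]big_mkcond.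
apply: eq_bigr => j _; have [->|ji] := eqVneq j i.
  by rewrite pairval_diag mul0r.
by rewrite /pairval; case: insubP => [e _ _|]; rewrite ?mul1r // cards2 (eq_sym i) ji.
Qed.

Lemma sum_pair_coef_le c : (forall i j, 0 <= c i j) ->
  \sum_e pair_coef c e <= \sum_i \sum_j c i j.
Proof.
move=> c0; rewrite sum_pair_coef; apply: ler_sum => i _.
by rewrite [leRHS](bigD1 i) //= lerDr.
Qed.

Lemma pair_coef_ge0 c e : (forall i j, 0 <= c i j) -> 0 <= pair_coef c e.
Proof. by move=> c0; do 2!apply: sumr_ge0 => ? _; rewrite mulr_ge0. Qed.

End Pairs.

Section Expectations.
Context {R : realType}.

Lemma sum_prod_bool (T : finType) (h : T -> bool -> R) :
  \sum_(F : {ffun T -> bool}) \prod_e h e (F e) =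
  \prod_e (h e true + h e false).
Proof.
rewrite -(bigA_distr_bigA h); apply: eq_bigr => e _.
by rewrite /index_enum !unlock /= addr0.
Qed.

Definition bern_ffun (T : finType) (r : T -> R) (F : {ffun T -> bool}) : R :=
  \prod_e bernoulli_pmf (r e) (F e).

Lemma sum_bern_ffun (T : finType) (r : T -> R) (h : T -> bool -> R) :
  \sum_F bern_ffun r F * \prod_e h e (F e) =
  \prod_e (r e * h e true + (1 - r e) * h e false).
Proof.
rewrite -(sum_prod_bool (fun e b => bernoulli_pmf (r e) b * h e b)).
by apply: eq_bigr => F _; rewrite big_split.
Qed.

Lemma sum_bern_ffun1 (T : finType) (r : T -> R) : \sum_F bern_ffun r F = 1.
Proof.
have := sum_bern_ffun r (fun _ _ => 1).
rewrite (eq_bigr (bern_ffun r)) => [->|F _]; last by rewrite big1 ?mulr1.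
by rewrite big1 // => e _; rewrite !mulr1 addrC subrK.
Qed.

Lemma bern_average_const (T : finType) (r : T -> R) (h : {ffun T -> bool} -> R) K :
  (forall F, h F = K) -> \sum_F bern_ffun r F * h F = K.
Proof.
move=> hK; under eq_bigr do rewrite hK.
by rewrite -mulr_suml sum_bern_ffun1 mul1r.
Qed.

Lemma bern_ffun_ge0 (T : finType) (r : T -> R) F :
  (forall e, 0 <= r e <= 1) -> 0 <= bern_ffun r F.
Proof. by move=> r01; apply: prodr_ge0 => e _; apply: bernoulli_pmf_ge0. Qed.

Lemma expR_sub1_le (x : R) : expR x - 1 <= expR x * x.
Proof.
have := expR_ge1Dx (- x); rewrite expRN => h.
have : expR x * (1 - x) <= expR x * (expR x)^-1 by rewrite ler_wpM2l // expR_ge0.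
by rewrite divff ?gt_eqF ?expR_gt0 // => ?; lra.
Qed.

Lemma bernoulli_mgf_le (a x theta : R) : 0 <= a -> 0 <= x <= theta ->
  a * expR x + (1 - a) <= expR (a * expR theta * x).
Proof.
move=> a0 /andP[x0 xt]; apply: le_trans (expR_ge1Dx _).
have h : expR x - 1 <= expR theta * x.
  by apply: le_trans (expR_sub1_le x) _; rewrite ler_wpM2r // ler_expR.
have : a * (expR x - 1) <= a * (expR theta * x) by rewrite ler_wpM2l.
lra.
Qed.

Lemma expR_le_quad (x : R) : `|x| <= 1 / 2 -> expR x <= 1 + x + 2 * x ^+ 2.
Proof.
rewrite ler_norml => /andP[x1 x2].
have := expR_ge1Dx (- x); rewrite expRN => h.
have d0 : 0 < 1 - x by lra.
have : expR x <= (1 - x)^-1.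
  by rewrite -[expR x]invrK lef_pV2 ?posrE ?invr_gt0 ?expR_gt0.
move=> h2; apply: le_trans h2 _.
rewrite -[(1 - x)^-1]mul1r ler_pdivrMr //.
have : 0 <= x ^+ 2 * (1 - 2 * x) by rewrite mulr_ge0 ?sqr_ge0 //; lra.
by move=> h3; lra.
Qed.

(* The involution exchanging the coordinates in [P] between two independent
   samples preserves their joint law. *)
Lemma resample (T : finType) (r : T -> R) (P : pred T)
    (f : {ffun T -> bool} -> R) :
  let mix (F G : {ffun T -> bool}) := [ffun e => if P e then G e else F e] in
  \sum_F bern_ffun r F * f F =
  \sum_F bern_ffun r F * \sum_G bern_ffun r G * f (mix F G).
Proof.
move=> mix.
have mixK F G : mix (mix F G) (mix G F) = F.
  by apply/ffunP => e; rewrite !ffunE; case: (P e).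
pose sw (x : {ffun T -> bool} * {ffun T -> bool}) := (mix x.1 x.2, mix x.2 x.1).
have swK : involutive sw by case=> F G; rewrite /sw /= !mixK.
have pm F G : bern_ffun r (mix F G) * bern_ffun r (mix G F) =
    bern_ffun r F * bern_ffun r G.
  rewrite -!big_split; apply: eq_bigr => e _ /=; rewrite !ffunE.
  by case: (P e) => //; rewrite mulrC.
transitivity (\sum_(x : {ffun T -> bool} * {ffun T -> bool})
    bern_ffun r x.1 * bern_ffun r x.2 * f x.1).
  rewrite -(pair_bigA _ (fun F G => bern_ffun r F * bern_ffun r G * f F)) /=.
  apply: eq_bigr => F _; rewrite -mulr_suml -mulr_sumr.
  by rewrite sum_bern_ffun1 mulr1.
rewrite (reindex_inj (inv_inj swK)) /=.
rewrite -(pair_bigA _ (fun F G => bern_ffun r (mix F G) * bern_ffun r (mix G F) * f (mix F G))) /=.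
apply: eq_bigr => F _; rewrite mulr_sumr; apply: eq_bigr => G _.
by rewrite pm mulrA.
Qed.

End Expectations.

Section CensoredModel.
Context {R : realType} (p q alpha : R) (n : nat).
Hypothesis p01 : 0 < p < 1.
Hypothesis q01 : 0 < q < 1.
Hypothesis alpha01 : 0 <= alpha <= 1.
Implicit Types (sigma : labels n) (E V : {ffun vpair n -> bool}).
Implicit Types (w : outcome n) (f : outcome n -> R) (x : vpair n -> R).

Definition edge_rate sigma (e : vpair n) : R := if same_label sigma e then p else q.

Definition csbm_ex f : R := \sum_w csbm_pmf p q alpha w * f w.

Lemma edge_rate01 sigma e : 0 <= edge_rate sigma e <= 1.
Proof.
by rewrite /edge_rate; case: ifP => _; [case/andP: p01|case/andP: q01] => a b; rewrite !ltW.
Qed.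

Lemma csbm_pmf_ge0 w : 0 <= csbm_pmf p q alpha w.
Proof.
rewrite /csbm_pmf !mulr_ge0 //.
- by apply: prodr_ge0 => i _; apply: bernoulli_pmf_ge0; rewrite invr_ge0 invf_le1 ?ler1n ?ler0n.
- by apply: prodr_ge0 => e _; apply: bernoulli_pmf_ge0; apply: edge_rate01.
- by apply: prodr_ge0 => e _; apply: bernoulli_pmf_ge0.
Qed.

Lemma csbm_exE f : csbm_ex f =
  \sum_sigma bern_ffun (fun=> 2^-1) sigma *
    \sum_E bern_ffun (edge_rate sigma) E *
      \sum_V bern_ffun (fun=> alpha) V * f (sigma, E, V).
Proof.
rewrite /csbm_ex.
transitivity (\sum_(x : labels n * {ffun vpair n -> bool}) \sum_V
    csbm_pmf p q alpha (x, V) * f (x, V)).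
  by rewrite pair_bigA; apply: eq_bigr; case=> x V _.
transitivity (\sum_sigma \sum_E \sum_V
    csbm_pmf p q alpha (sigma, E, V) * f (sigma, E, V)).
  by rewrite [RHS]pair_bigA /=; apply: eq_bigr; case.
apply: eq_bigr => sigma _; rewrite mulr_sumr; apply: eq_bigr => E _.
rewrite 2!mulr_sumr; apply: eq_bigr => V _.
by rewrite /csbm_pmf /= /bern_ffun !mulrA.
Qed.

Lemma csbm_pr_ex (A : pred (outcome n)) :
  csbm_pr p q alpha A = csbm_ex (fun w => (A w)%:R).
Proof.
rewrite /csbm_pr big_mkcond; apply: eq_bigr => w _.
by case: (A w); rewrite ?mulr1 ?mulr0.
Qed.

Lemma csbm_ex1 : csbm_ex (fun=> 1) = 1.
Proof.
rewrite csbm_exE -[RHS](sum_bern_ffun1 (T := 'I_n) (fun=> 2^-1)); apply: eq_bigr => sigma _.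
rewrite -[RHS]mulr1; congr (_ * _).
rewrite -[RHS](sum_bern_ffun1 (edge_rate sigma)); apply: eq_bigr => E _.
rewrite -[RHS]mulr1; congr (_ * _).
rewrite -[RHS](sum_bern_ffun1 (T := vpair n) (fun=> alpha)); apply: eq_bigr => V _.
by rewrite mulr1.
Qed.

Lemma le_csbm_ex f g : (forall w, f w <= g w) -> csbm_ex f <= csbm_ex g.
Proof. by move=> fg; apply: ler_sum => w _; rewrite ler_wpM2l ?csbm_pmf_ge0. Qed.

Lemma csbm_pr_le1 (A : pred (outcome n)) : csbm_pr p q alpha A <= 1.
Proof.
rewrite csbm_pr_ex -[leRHS]csbm_ex1; apply: le_csbm_ex => w.
by case: (A w); rewrite ?ler01 ?lexx.
Qed.

Lemma bern_average_le (T : finType) (r : T -> R) (h : {ffun T -> bool} -> R) K :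
  (forall e, 0 <= r e <= 1) -> (forall F, h F <= K) ->
  \sum_F bern_ffun r F * h F <= K.
Proof.
move=> r01 hK; apply: le_trans (_ : \sum_F bern_ffun r F * K <= _).
  by apply: ler_sum => F _; rewrite ler_wpM2l // bern_ffun_ge0.
by rewrite -mulr_suml sum_bern_ffun1 mul1r.
Qed.

Lemma csbm_ex_le_labels f K :
  (forall sigma, \sum_E bern_ffun (edge_rate sigma) E *
     \sum_V bern_ffun (fun=> alpha) V * f (sigma, E, V) <= K) ->
  csbm_ex f <= K.
Proof.
move=> h; rewrite csbm_exE; apply: bern_average_le => // _.
by rewrite invr_ge0 invf_le1 ?ler1n ?ler0n.
Qed.

Lemma csbm_ex_le_edges f K :
  (forall sigma E, \sum_V bern_ffun (fun=> alpha) V * f (sigma, E, V) <= K) ->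
  csbm_ex f <= K.
Proof.
move=> h; apply: csbm_ex_le_labels => sigma; apply: bern_average_le => //.
exact: edge_rate01.
Qed.

(** Union bound and Markov's inequality in one step: where [A] holds, one of the exponentials is at
    least 1. Thresholds are meant to be subtracted inside [X]. *)
Lemma csbm_pr_chernoff (K : finType) (P : pred K) (X : K -> outcome n -> R)
    (A : pred (outcome n)) :
  (forall w, A w -> exists2 k, P k & 0 <= X k w) ->
  csbm_pr p q alpha A <= \sum_(k | P k) csbm_ex (fun w => expR (X k w)).
Proof.
move=> AX; rewrite csbm_pr_ex [leRHS]exchange_big; apply: ler_sum => w _ /=.
rewrite -mulr_sumr ler_wpM2l ?csbm_pmf_ge0 //.
case: (boolP (A w)) => [/AX[k Pk Xk]|_]; last by apply: sumr_ge0 => k _; exact: expR_ge0.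
rewrite (bigD1 k) //=; apply: le_trans (_ : expR (X k w) <= _).
  by rewrite -expR0 ler_expR.
by rewrite lerDl; apply: sumr_ge0 => k' _; exact: expR_ge0.
Qed.

Lemma csbm_pr_chernoff_le (K : finType) (P : pred K) (X : K -> outcome n -> R)
    (A : pred (outcome n)) (Y : K -> R) :
  (forall w, A w -> exists2 k, P k & 0 <= X k w) ->
  (forall k, P k -> csbm_ex (fun w => expR (X k w)) <= Y k) ->
  csbm_pr p q alpha A <= \sum_(k | P k) Y k.
Proof.
move=> AX XY; apply: le_trans (csbm_pr_chernoff AX) _.
exact: ler_sum.
Qed.

Lemma revealed_mgf x :
  \sum_V bern_ffun (fun=> alpha) V * expR (\sum_e (V e)%:R * x e) =
  \prod_e (alpha * expR (x e) + (1 - alpha)).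
Proof.
transitivity (\sum_V bern_ffun (fun=> alpha) V * \prod_e expR ((V e)%:R * x e)).
  by apply: eq_bigr => V _; rewrite expR_sum.
rewrite (sum_bern_ffun (fun=> alpha) (fun e b => expR (b%:R * x e))).
by apply: eq_bigr => e _; rewrite mul1r mul0r expR0 mulr1.
Qed.

(** On [0, theta] the exponential has slope at most [expR theta], which makes the exponent linear in
    [c]. The bound does not involve labels or edges, so it may be used conditionally on them, with
    [c] depending on both. *)
Lemma revealed_chernoff (c : 'I_n -> 'I_n -> R) (theta : R) :
  (forall i j, 0 <= c i j) -> (forall e, pair_coef c e <= theta) ->
  \sum_V bern_ffun (fun=> alpha) V *
    expR (\sum_i \sum_j pairval (fun e => (V e)%:R) i j * c i j) <=
  expR (alpha * expR theta * \sum_i \sum_j c i j).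
Proof.
move=> c0 ct; have /andP[a0 a1] := alpha01.
rewrite (eq_bigr (fun V => bern_ffun (fun=> alpha) V *
  expR (\sum_e (V e)%:R * pair_coef c e))) => [|V _]; last by rewrite pair_sum.
rewrite revealed_mgf.
apply: le_trans (_ : \prod_e expR (alpha * expR theta * pair_coef c e) <= _).
  apply: ler_prod => e _; rewrite bernoulli_mgf_le ?pair_coef_ge0 ?ct // andbT.
  by rewrite addr_ge0 ?subr_ge0 // mulr_ge0 // expR_ge0.
rewrite -expR_sum ler_expR -mulr_sumr ler_wpM2l ?mulr_ge0 ?expR_ge0 //.
exact: sum_pair_coef_le.
Qed.

Definition llr_present : R := ln (p / q).
Definition llr_absent : R := ln ((1 - p) / (1 - q)).

Definition llr E V (e : vpair n) : R :=
  if V e then if E e then llr_present else llr_absent else 0.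

Lemma llr_mgf sigma x :
  \sum_E bern_ffun (edge_rate sigma) E * \sum_V bern_ffun (fun=> alpha) V *
    expR (\sum_e llr E V e * x e) =
  \prod_e (alpha * (edge_rate sigma e * expR (llr_present * x e) +
     (1 - edge_rate sigma e) * expR (llr_absent * x e)) + (1 - alpha)).
Proof.
transitivity (\sum_E bern_ffun (edge_rate sigma) E * \prod_e
    (alpha * expR ((if E e then llr_present else llr_absent) * x e) + (1 - alpha))).
  apply: eq_bigr => E _; congr (_ * _).
  rewrite -(revealed_mgf (fun e => (if E e then llr_present else llr_absent) * x e)).
  apply: eq_bigr => V _; congr (_ * expR _); apply: eq_bigr => e _.
  by rewrite /llr; case: (V e); rewrite ?mul1r ?mul0r.
rewrite (sum_bern_ffun (edge_rate sigma) (fun e b =>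
  alpha * expR ((if b then llr_present else llr_absent) * x e) + (1 - alpha))).
by apply: eq_bigr => e _; ring.
Qed.

End CensoredModel.

(** * Hellinger affinity and divergences of the two edge laws *)

Section LogLikelihoodRatio.
Context {R : realType} (p q : R).
Hypothesis p01 : 0 < p < 1.
Hypothesis q01 : 0 < q < 1.

Local Notation w1 := (llr_present p q).
Local Notation w0 := (llr_absent p q).

(** One minus the Bhattacharyya coefficient of the Bernoulli laws with parameters [p] and [q]; its
    inverse is the threshold, by [t_cE]. *)
Definition hellinger_gap : R :=
  1 - Num.sqrt p * Num.sqrt q - Num.sqrt (1 - p) * Num.sqrt (1 - q).

Let sqs (a : R) : 0 < a < 1 ->
  [/\ 0 < Num.sqrt a, 0 < Num.sqrt (1 - a), Num.sqrt a ^+ 2 = a &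
      Num.sqrt (1 - a) ^+ 2 = 1 - a].
Proof.
case/andP=> a0 a1; have b0 : 0 < 1 - a by rewrite subr_gt0.
by rewrite !sqrtr_gt0 a0 b0 !sqr_sqrtr ?ltW.
Qed.

Lemma expR_half_ln (a b : R) : 0 < a -> 0 < b ->
  expR (ln (a ^+ 2 / b ^+ 2) * 2^-1) = a / b /\
  expR (ln (a ^+ 2 / b ^+ 2) * - 2^-1) = b / a.
Proof.
move=> a0 b0; have ab : 0 < a / b by rewrite divr_gt0.
rewrite -expr_div_n lnXn // -(mulr_natr (ln _)) -mulrA divff ?pnatr_eq0 // mulr1.
rewrite -mulrA mulrN divff ?pnatr_eq0 // mulrN1 expRN lnK ?posrE //.
by rewrite invf_div.
Qed.

Lemma llr_hellinger_same :
  p * expR (w1 * - 2^-1) + (1 - p) * expR (w0 * - 2^-1) = 1 - hellinger_gap.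
Proof.
have [a0 c0 ap cp] := sqs p01; have [b0 d0 bq dq] := sqs q01.
rewrite /llr_present /llr_absent /hellinger_gap.
have [_] := expR_half_ln a0 b0; have [_] := expR_half_ln c0 d0.
rewrite ap bq cp dq => -> ->.
rewrite -{1}ap -{1}cp; field; rewrite !gt_eqF //.
Qed.

Lemma llr_hellinger_diff :
  q * expR (w1 * 2^-1) + (1 - q) * expR (w0 * 2^-1) = 1 - hellinger_gap.
Proof.
have [a0 c0 ap cp] := sqs p01; have [b0 d0 bq dq] := sqs q01.
rewrite /llr_present /llr_absent /hellinger_gap.
have [+ _] := expR_half_ln a0 b0; have [+ _] := expR_half_ln c0 d0.
rewrite ap bq cp dq => -> ->.
rewrite -{1}bq -{1}dq; field; rewrite !gt_eqF //.
Qed.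

Lemma t_cE : t_c p q = hellinger_gap^-1.
Proof.
have [a0 c0 ap cp] := sqs p01; have [b0 d0 bq dq] := sqs q01.
rewrite /t_c /hellinger_gap.
have -> : (Num.sqrt p - Num.sqrt q) ^+ 2 + (Num.sqrt (1 - q) - Num.sqrt (1 - p)) ^+ 2 =
  2 * (1 - Num.sqrt p * Num.sqrt q - Num.sqrt (1 - p) * Num.sqrt (1 - q)).
  rewrite !sqrrB ap bq cp dq; ring.
by rewrite invfM mulrA divff ?pnatr_eq0 // mul1r.
Qed.

Hypothesis pq : p != q.

Lemma hellinger_gap_gt0 : 0 < hellinger_gap.
Proof.
have [a0 c0 ap cp] := sqs p01; have [b0 d0 bq dq] := sqs q01.
have h : 0 < (Num.sqrt p - Num.sqrt q) ^+ 2.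
  rewrite lt_neqAle sqr_ge0 andbT eq_sym sqrf_eq0 subr_eq0.
  by apply: contra pq => /eqP e; rewrite -ap -bq e.
have h2 := sqr_ge0 (Num.sqrt (1 - q) - Num.sqrt (1 - p)).
move: h h2; rewrite !sqrrB ap bq cp dq /hellinger_gap; lra.
Qed.

(** Gibbs' inequality: [x - y < x * ln (x / y)] for each of the two outcomes, and the left-hand
    sides cancel in the sum. *)
Lemma kl_gt0 (a b : R) : 0 < a < 1 -> 0 < b < 1 -> a != b ->
  0 < a * ln (a / b) + (1 - a) * ln ((1 - a) / (1 - b)).
Proof.
move=> /andP[a0 a1] /andP[b0 b1] ab.
have step (x y : R) : 0 < x -> 0 < y -> x != y -> x - y < x * ln (x / y).
  move=> x0 y0 xy; have xy0 : 0 < x / y by rewrite divr_gt0.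
  have n0 : - ln (x / y) != 0.
    rewrite oppr_eq0 ln_eq0 //; apply: contra xy => /eqP h.
    by rewrite -(divfK (lt0r_neq0 y0) x) h mul1r.
  have := expR_gt1Dx n0; rewrite expRN lnK ?posrE // invf_div => h.
  have : x * (1 - ln (x / y)) < x * (y / x) by rewrite ltr_pM2l.
  by rewrite mulrCA divff ?gt_eqF // mulr1; lra.
have h1 := step a b a0 b0 ab.
have ab' : 1 - a != 1 - b by apply: contra ab => /eqP h; apply/eqP; lra.
have h2 : (1 - a) - (1 - b) < (1 - a) * ln ((1 - a) / (1 - b)).
  by apply: step => //; rewrite subr_gt0.
lra.
Qed.

(** [mean_same] is the divergence KL(p | q) and [mean_diff] is - KL(q | p), which explains their
    signs. *)
Definition mean_same : R := p * w1 + (1 - p) * w0.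
Definition mean_diff : R := q * w1 + (1 - q) * w0.

Lemma mean_same_gt0 : 0 < mean_same.
Proof. exact: kl_gt0. Qed.

Lemma mean_diff_lt0 : mean_diff < 0.
Proof.
have qp : q != p by rewrite eq_sym.
have := kl_gt0 q01 p01 qp; rewrite /mean_diff /llr_present /llr_absent.
have /andP[p0 p1] := p01; have /andP[q0 q1] := q01.
have p1' : 0 < 1 - p by rewrite subr_gt0.
have q1' : 0 < 1 - q by rewrite subr_gt0.
rewrite !ln_div ?posrE //; lra.
Qed.

Lemma llr_mgf_quad (alpha r x B : R) : 0 <= alpha -> 0 <= r <= 1 ->
  `|w1| <= B -> `|w0| <= B -> B * `|x| <= 1 / 2 ->
  alpha * (r * expR (w1 * x) + (1 - r) * expR (w0 * x)) + (1 - alpha) <=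
  expR (alpha * (x * (r * w1 + (1 - r) * w0) + 2 * B ^+ 2 * x ^+ 2)).
Proof.
move=> a0 /andP[r0 r1] w1B w0B xB; apply: le_trans (expR_ge1Dx _).
have step v : `|v| <= B -> expR (v * x) <= 1 + v * x + 2 * B ^+ 2 * x ^+ 2.
  move=> vB; have h : `|v * x| <= 1 / 2.
    by rewrite normrM (le_trans _ xB) // ler_wpM2r.
  apply: le_trans (expR_le_quad h) _; rewrite lerD2l -mulrA ler_pM2l // exprMn.
  rewrite ler_wpM2r ?sqr_ge0 // -real_normK ?num_real //.
  by rewrite ler_sqr ?nnegrE // (le_trans _ vB).
have h1 : r * expR (w1 * x) <= r * (1 + w1 * x + 2 * B ^+ 2 * x ^+ 2).
  by rewrite ler_wpM2l // step.
have h0 : (1 - r) * expR (w0 * x) <= (1 - r) * (1 + w0 * x + 2 * B ^+ 2 * x ^+ 2).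
  by rewrite ler_wpM2l ?subr_ge0 // step.
have : alpha * (r * expR (w1 * x) + (1 - r) * expR (w0 * x)) <=
  alpha * (1 + x * (r * w1 + (1 - r) * w0) + 2 * B ^+ 2 * x ^+ 2).
  by rewrite ler_wpM2l //; lra.
lra.
Qed.

End LogLikelihoodRatio.

(** * Concentration events *)

Lemma same_label2 n (sigma : labels n) (e : vpair n) a b :
  val e = [set a; b]%SET -> same_label sigma e = (sigma a == sigma b).
Proof.
move=> ev; rewrite /same_label ev; apply/idP/eqP => [|sab].
  move=> /forall_inP /(_ a); rewrite !inE eqxx => /(_ isT) /forall_inP /(_ b).
  by rewrite !inE eqxx orbT => /(_ isT) /eqP.
apply/forall_inP => i ia; apply/forall_inP => j ja; move: ia ja; rewrite !inE.
by case/orP => /eqP->; case/orP => /eqP->; rewrite ?sab.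
Qed.

Lemma spin_addb (R : realType) (a b : bool) : spin a * spin b = spin (a (+) b) :> R.
Proof. by rewrite /spin signr_addb. Qed.

Definition revealed {R : realType} n (w : outcome n) : 'I_n -> 'I_n -> R :=
  pairval (fun e => (w.2 e)%:R).

Definition llr_mx {R : realType} (p q : R) n (w : outcome n) : 'I_n -> 'I_n -> R :=
  pairval (llr p q w.1.2 w.2).

Definition spins {R : realType} n (w : outcome n) : 'I_n -> R :=
  fun i => spin (sigma0 w i).

(** Leave-one-out inside the model: the matrix of the censored outcome is [erase k] of the original
    one, so a choice of eigenvectors evaluated there provides the comparison vector. Edges at [k]
    are kept in the outcome but cannot be observed. *)
Definition censor_row n (k : 'I_n) (w : outcome n) : outcome n :=
  (w.1, [ffun e : vpair n => (k \notin val e) && w.2 e]).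

Section BadEvents.
Context {R : realType} (p q t : R) (n : nat).
Hypothesis p01 : 0 < p < 1.
Hypothesis q01 : 0 < q < 1.
Hypothesis t0 : 0 < t.
Hypothesis n0 : (0 < n)%N.
Local Notation alpha := (reveal_prob t n).
Local Notation l := (ln n%:R : R).
Hypothesis alpha01 : 0 <= alpha <= 1.

Let nR : 0 < n%:R :> R. Proof. by rewrite ltr0n. Qed.
Let alpha_n : alpha * n%:R = t * l.
Proof. by rewrite /reveal_prob divfK // gt_eqF. Qed.
Let l_ge0 : 0 <= l. Proof. by apply: ln_ge0; rewrite ler1n. Qed.
Let exp_l : expR l = n%:R. Proof. by rewrite lnK // posrE. Qed.
Let l_le_n : l <= n%:R. Proof. by apply: ltW; apply: ln_sublinear. Qed.

Lemma union_exp (x : R) : \sum_(i < n) expR x = expR (l + x).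
Proof. by rewrite sumr_const card_ord -[LHS]mulr_natl expRD exp_l. Qed.

Lemma row_coef_le (i0 : 'I_n) (h : 'I_n -> R) theta (e : vpair n) :
  0 <= theta -> (forall j, 0 <= h j <= theta) ->
  pair_coef (fun i j => (i == i0)%:R * h j) e <= theta.
Proof.
move=> th0 h01; have [a [b [ab ev]]] := vpairP e; rewrite (pair_coef2 _ ab ev).
have /andP[ha ha'] := h01 a; have /andP[hb hb'] := h01 b.
have [ea|na] := eqVneq a i0; have [eb|nb] := eqVneq b i0; rewrite ?mul1r ?mul0r ?addr0 ?add0r //.
by move: ab; rewrite ea eb eqxx.
Qed.

Lemma row_sum (i0 : 'I_n) (F : 'I_n -> 'I_n -> R) (h : 'I_n -> R) :
  \sum_i \sum_j F i j * ((i == i0)%:R * h j) = \sum_j F i0 j * h j.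
Proof.
rewrite (bigD1 i0) //= [X in _ + X]big1 ?addr0.
  by apply: eq_bigr => j _; rewrite eqxx mul1r.
by move=> i /negbTE ->; rewrite big1 // => j _; rewrite mul0r mulr0.
Qed.

Lemma row_sum1 (i0 : 'I_n) (h : 'I_n -> R) :
  \sum_i \sum_j (i == i0)%:R * h j = \sum_j h j.
Proof.
rewrite (bigD1 i0) //= [X in _ + X]big1 ?addr0.
  by apply: eq_bigr => j _; rewrite eqxx mul1r.
by move=> i /negbTE ->; rewrite big1 // => j _; rewrite mul0r.
Qed.

Lemma csbm_ex_shift (f : outcome n -> R) (a K : R) :
  csbm_ex p q alpha (fun w => expR (f w)) <= expR K ->
  csbm_ex p q alpha (fun w => expR (f w - a)) <= expR (K - a).
Proof.
move=> h; have -> : csbm_ex p q alpha (fun w => expR (f w - a)) =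
    expR (- a) * csbm_ex p q alpha (fun w => expR (f w)).
  by rewrite mulr_sumr; apply: eq_bigr => w _; rewrite expRD; ring.
by rewrite expRD mulrC ler_wpM2r // expR_ge0.
Qed.

(** Chernoff at exponent 1 gives [t * expR 1 * l]; of the additional [2 * l] in the threshold, one
    [l] pays for the union over rows. *)
Lemma degree_bad (D : R) : D = t * expR 1 + 2 ->
  csbm_pr p q alpha
    (fun w : outcome n => `[< exists i, D * l < \sum_j revealed w i j >]) <=
  expR (- l).
Proof.
move=> DE; have -> : - l = l + (t * expR 1 * l - D * l) by rewrite DE; ring.
rewrite -union_exp; apply: (csbm_pr_chernoff_le p01 q01 alpha01
  (X := fun i w => \sum_j revealed w i j - D * l)).
  by move=> w /asboolP[i h]; exists i => //; rewrite subr_ge0 ltW.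
move=> i _; apply: csbm_ex_shift; apply: csbm_ex_le_edges => // sigma E.
rewrite (eq_bigr (fun V : {ffun vpair n -> bool} => bern_ffun (fun=> alpha) V *
  expR (\sum_i' \sum_j pairval (fun e => (V e)%:R) i' j * ((i' == i)%:R * 1)))) => [|V _].
  apply: le_trans (revealed_chernoff alpha01 (theta := 1) _ _) _.
  - by move=> i' j; rewrite mulr1.
  - by move=> e; apply: row_coef_le => // j; rewrite ler01 lexx.
  - by rewrite (row_sum1 i (fun=> 1)) sumr_const card_ord mulrAC alpha_n mulrAC.
rewrite (row_sum i _ (fun=> 1)); congr (_ * expR _).
by apply: eq_bigr => j _; rewrite mulr1.
Qed.

Lemma sum_powers_card (x : R) :
  \sum_(T : {set 'I_n} | T != finset.set0) x ^+ #|T| = (1 + x) ^+ n - 1.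
Proof.
have : \prod_(i < n) (x + 1) = \sum_(T : {set 'I_n}) x ^+ #|T|.
  rewrite bigA_distr; apply: eq_bigr => T _.
  rewrite -big_mkcond /= [RHS](_ : _ = \prod_(i in T) x) ?prodr_const //.
rewrite prodr_const card_ord (bigD1 finset.set0) //= cards0 expr0 => h.
by rewrite [1 + x]addrC h [RHS]addrC addKr.
Qed.

(** With [theta = 3 / e ^+ 2] the threshold is worth 3 l |T|, and the smallness of [d] limits the
    moment to l |T|. Each set thus has probability at most n^(-2 |T|), and the sum over nonempty
    sets is (1 + n^-2)^n - 1 = O(1 / n). The exponent [2 * theta] occurs because a pair inside [T]
    is counted twice. *)
Lemma sparse_bad (e d theta : R) : 0 < e <= 1 -> 0 < d <= 1 ->
  theta = 3 / e ^+ 2 -> t * expR (2 * theta) * theta * d ^+ 2 <= 1 ->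
  csbm_pr p q alpha
    (fun w : outcome n => `[< ~ sparse_on_small (revealed w) d e l >]) <=
  expR 1 * expR (- l).
Proof.
move=> /andP[e0 e1] /andP[d0 d1] thE hd.
have e2 : 0 < e ^+ 2 by rewrite exprn_gt0.
have th0 : 0 < theta by rewrite thE divr_gt0.
apply: le_trans (_ : \sum_(T : {set 'I_n} | (T != finset.set0) && (#|T|%:R <= d ^+ 2 * n%:R))
    expR (- 2 * l) ^+ #|T| <= _).
  apply: (csbm_pr_chernoff_le p01 q01 alpha01 (X := fun (T : {set 'I_n}) w =>
    theta * \sum_(i in T) \sum_(j in T) revealed w i j - 3 * l * #|T|%:R)).
    move=> w /asboolP; rewrite /sparse_on_small => /existsNP[T /not_implyP[Td h]].
    exists T.
      rewrite Td andbT; apply/eqP => T0; apply: h.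
      by rewrite T0 big_set0 cards0 mulr0.
    move/negP: h; rewrite -ltNge => h; rewrite subr_ge0.
    have -> : 3 * l * #|T|%:R = theta * (e ^+ 2 * l * #|T|%:R).
      by rewrite thE; field; rewrite gt_eqF.
    by rewrite ler_pM2l // ltW.
  move=> T /andP[_ Td].
  have -> : expR (- 2 * l) ^+ #|T| = expR (l * #|T|%:R - 3 * l * #|T|%:R).
    by rewrite -expRM_natr; congr expR; ring.
  apply: csbm_ex_shift; apply: csbm_ex_le_edges => // sigma E.
  pose c (i j : 'I_n) : R := theta * ((i \in T)%:R * (j \in T)%:R).
  have cT (F : 'I_n -> 'I_n -> R) : \sum_i \sum_j F i j * c i j =
      theta * \sum_(i in T) \sum_(j in T) F i j.
    rewrite mulr_sumr [RHS]big_mkcond; apply: eq_bigr => i _.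
    case: ifPn => iT; last first.
      by rewrite big1 // => j _; rewrite /c (negbTE iT) mul0r !mulr0.
    rewrite mulr_sumr [RHS]big_mkcond; apply: eq_bigr => j _.
    by rewrite /c iT; case: (j \in T); rewrite ?mulr0 ?mul1r ?mulr1 // mulrC.
  rewrite (eq_bigr (fun V : {ffun vpair n -> bool} => bern_ffun (fun=> alpha) V *
    expR (\sum_i \sum_j pairval (fun e => (V e)%:R) i j * c i j))) => [|V _].
    apply: le_trans (revealed_chernoff alpha01 (theta := 2 * theta) _ _) _.
    - by move=> i j; rewrite /c !mulr_ge0 // ltW.
    - move=> f; have [a [b [ab ev]]] := vpairP f; rewrite (pair_coef2 _ ab ev) /c.
      by case: (a \in T); case: (b \in T); rewrite ?mulr0 ?mul0r ?addr0 ?mulr1 //; lra.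
    - rewrite ler_expR.
      have -> : \sum_i \sum_j c i j = theta * (#|T|%:R * #|T|%:R).
        transitivity (\sum_i \sum_j 1 * c i j).
          by apply: eq_bigr => i _; apply: eq_bigr => j _; rewrite mul1r.
        rewrite (cT (fun _ _ => 1)); congr (_ * _).
        by rewrite sumr_const sumr_const -[LHS]mulr_natl.
      have /andP[a0 _] := alpha01.
      apply: le_trans (_ : alpha * expR (2 * theta) * (theta * (#|T|%:R * (d ^+ 2 * n%:R))) <= _).
        by rewrite !ler_wpM2l // ?mulr_ge0 ?expR_ge0 // ltW.
      have -> : alpha * expR (2 * theta) * (theta * (#|T|%:R * (d ^+ 2 * n%:R))) =
        (alpha * n%:R) * #|T|%:R * (expR (2 * theta) * theta * d ^+ 2) by ring.
      rewrite alpha_n.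
      have -> : t * l * #|T|%:R * (expR (2 * theta) * theta * d ^+ 2) =
        l * #|T|%:R * (t * expR (2 * theta) * theta * d ^+ 2) by ring.
      by rewrite ler_piMr // mulr_ge0.
  by rewrite cT.
apply: le_trans (_ : \sum_(T : {set 'I_n} | T != finset.set0) expR (- 2 * l) ^+ #|T| <= _).
  rewrite [leRHS](bigID (fun T : {set 'I_n} => #|T|%:R <= d ^+ 2 * n%:R)) /= lerDl.
  by apply: sumr_ge0 => T _; rewrite exprn_ge0 // expR_ge0.
rewrite sum_powers_card.
set y := expR (- l).
have y0 : 0 <= y by apply: expR_ge0.
have y1 : y <= 1 by rewrite expR_le1 oppr_le0.
have h1 : (1 + expR (- 2 * l)) ^+ n <= expR y.
  apply: le_trans (_ : expR (expR (- 2 * l)) ^+ n <= _).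
    by rewrite lerXn2r ?nnegrE ?expR_ge1Dx ?expR_ge0 // addr_ge0 ?expR_ge0.
  rewrite -expRM_natl ler_expR -{1}exp_l -expRD ler_expR; lra.
have h4 := expR_sub1_le y.
have h5 : expR y * y <= expR 1 * y by rewrite ler_wpM2r // ler_expR.
lra.
Qed.

(** The weights [h k] are read from the outcome with row [k] censored. Redrawing the reveal
    indicators at [k] leaves them unchanged and makes the row independent of them, so Chernoff
    applies with fixed weights of small total mass, conditionally on labels, edges and the other
    indicators. *)
Lemma row_resample_bad (delta eps theta : R) (h : 'I_n -> outcome n -> 'I_n -> R) :
  0 < delta -> (forall k w j, 0 <= h k w j <= 1) ->
  (forall k w, \sum_j h k w j <= eps * n%:R) ->
  theta = 3 / delta -> t * expR theta * theta * eps <= 1 ->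
  csbm_pr p q alpha
    (fun w : outcome n => `[< exists k, delta * l <
       \sum_j revealed w k j * h k (censor_row k w) j >]) <= expR (- l).
Proof.
move=> d0 h01 hs thE heps; have th0 : 0 < theta by rewrite thE divr_gt0.
have -> : - l = l + (l - 3 * l) by ring.
rewrite -union_exp; apply: (csbm_pr_chernoff_le p01 q01 alpha01
  (X := fun k w => theta * \sum_j revealed w k j * h k (censor_row k w) j - 3 * l)).
  move=> w /asboolP[k hk]; exists k => //; rewrite subr_ge0.
  have -> : 3 * l = theta * (delta * l) by rewrite thE; field; rewrite gt_eqF.
  by rewrite ler_pM2l // ltW.
move=> k _; apply: csbm_ex_shift; apply: csbm_ex_le_edges => // sigma E.
rewrite (resample _ (fun e : vpair n => k \in val e)).
apply: bern_average_le => // F.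
set hF := h k (censor_row k (sigma, E, F)).
rewrite (eq_bigr (fun G : {ffun vpair n -> bool} => bern_ffun (fun=> alpha) G *
  expR (\sum_i \sum_j pairval (fun e => (G e)%:R) i j *
     ((i == k)%:R * (theta * hF j))))) => [|G _].
  apply: le_trans (revealed_chernoff alpha01 (theta := theta) _ _) _.
  - by move=> i j; rewrite !mulr_ge0 // ?(ltW th0) //; case/andP: (h01 k (censor_row k (sigma, E, F)) j).
  - move=> e; apply: row_coef_le => [|j]; first exact: ltW.
    have /andP[a b] := h01 k (censor_row k (sigma, E, F)) j.
    by rewrite mulr_ge0 ?(ltW th0) //= ler_piMr // ltW.
  - rewrite (row_sum1 k (fun j => theta * hF j)) -mulr_sumr ler_expR.
    have /andP[a0 _] := alpha01.
    apply: le_trans (_ : alpha * expR theta * (theta * (eps * n%:R)) <= _).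
      apply: ler_wpM2l; first by rewrite mulr_ge0 ?expR_ge0.
      by apply: ler_wpM2l; [exact: ltW|exact: hs].
    have -> : alpha * expR theta * (theta * (eps * n%:R)) =
      (alpha * n%:R) * (expR theta * theta * eps) by ring.
    rewrite alpha_n.
    have -> : t * l * (expR theta * theta * eps) = l * (t * expR theta * theta * eps) by ring.
    by rewrite ler_piMr.
congr (_ * expR _).
rewrite (row_sum k _ (fun j => theta * hF j)) mulr_sumr.
set mixFG := [ffun e => _].
have -> : censor_row k (sigma, E, mixFG) = censor_row k (sigma, E, F).
  congr (_, _); apply/ffunP => e; rewrite !ffunE /= ?ffunE.
  by case: (k \in val e).
apply: eq_bigr => j _; rewrite mulrCA; congr (_ * _).
rewrite /revealed /pairval; case: insubP => // e _ ev /=.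
by rewrite ffunE ev !inE eqxx.
Qed.

Hypothesis pq : p != q.

(* Chernoff's bound at exponent 1/2: the exponential moment is then the
   Hellinger affinity of the two edge laws, whatever the labels. *)
Lemma margin_bad (m : R) : m = t * hellinger_gap p q - 1 ->
  csbm_pr p q alpha (fun w : outcome n =>
    `[< exists i, \sum_j spins w i * spins w j * llr_mx p q w i j < m * l >]) <=
  expR (t * hellinger_gap p q) * expR (- (m / 2) * l).
Proof.
move=> mE; set H := hellinger_gap p q.
have hs := llr_hellinger_same p01 q01; have hd := llr_hellinger_diff p01 q01.
have tH : 0 < t * H.
  by rewrite mulr_gt0 // hellinger_gap_gt0.
(* A row has [n - 1] pairs, not [n]; the missing one costs [alpha * H <= t * H], hence the
   prefactor. The threshold [m * l] costs half of the surplus [m = t * H - 1], and the other half is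
   the rate. *)
apply: le_trans (_ : expR (l + (- (alpha * H * (n%:R - 1)) - - (m / 2) * l)) <= _); last first.
  rewrite -expRD ler_expR.
  have -> : alpha * H * (n%:R - 1) = H * (alpha * n%:R) - alpha * H by ring.
  rewrite alpha_n.
  have : alpha * H <= t * H.
    apply: ler_wpM2r; first by rewrite ltW // hellinger_gap_gt0.
    by rewrite /reveal_prob -mulrA ler_piMr ?(ltW t0) // ler_pdivrMr ?mul1r.
  rewrite mE -/H; lra.
rewrite -union_exp //; apply: (csbm_pr_chernoff_le p01 q01 alpha01 (X := fun i w =>
   - 2^-1 * \sum_j spins w i * spins w j * llr_mx p q w i j - - (m / 2) * l)).
  move=> w /asboolP[i h]; exists i => //; lra.
move=> i0 _; apply: csbm_ex_shift; apply: csbm_ex_le_labels => // sigma.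
pose s i := spin (sigma i) : R.
pose c (i j : 'I_n) := (i == i0)%:R * (- 2^-1 * (s i0 * s j)).
pose d (i j : 'I_n) : R := (i == i0)%:R * 1.
rewrite (eq_bigr (fun E : {ffun vpair n -> bool} => bern_ffun (edge_rate p q sigma) E *
  \sum_V bern_ffun (fun=> alpha) V * expR (\sum_e llr p q E V e * pair_coef c e))) => [|E _].
  rewrite llr_mgf.
  apply: le_trans (_ : \prod_e expR (- (alpha * H) * pair_coef d e) <= _).
    apply: ler_prod => e _; apply/andP; split.
      have /andP[r0 r1] := edge_rate01 p01 q01 sigma e.
      have /andP[a0 a1] := alpha01.
      by rewrite addr_ge0 ?subr_ge0 // mulr_ge0 // addr_ge0 // mulr_ge0 ?expR_ge0 ?subr_ge0.
    have [a [b [ab ev]]] := vpairP e.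
    rewrite !(pair_coef2 _ ab ev) /edge_rate (same_label2 sigma ev).
    have sE : s a * s b = if sigma a == sigma b then 1 else -1.
      by rewrite /s /spin -signr_addb; case: (sigma a); case: (sigma b).
    have bnd x r : x = (if sigma a == sigma b then - 2^-1 else 2^-1) ->
        r = (if sigma a == sigma b then p else q) ->
        alpha * (r * expR (llr_present p q * x) + (1 - r) * expR (llr_absent p q * x)) +
          (1 - alpha) <= expR (- (alpha * H)).
      move=> -> ->; apply: le_trans (expR_ge1Dx _).
      rewrite le_eqVlt; apply/orP; left; apply/eqP.
      by case: ifP => _; [rewrite hs|rewrite hd]; rewrite -/H; ring.
    rewrite /c /d; have [ea|na] := eqVneq a i0; have [eb|nb] := eqVneq b i0.
    - by move: ab; rewrite ea eb eqxx.
    - rewrite !mul1r !mul0r !addr0 mulr1; apply: bnd => //.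
      by rewrite -ea sE; case: ifP => _; rewrite ?mulr1 ?mulrN1 ?opprK.
    - rewrite !mul1r !mul0r !add0r mulr1; apply: bnd => //.
      by rewrite -eb mulrC [s b * _]mulrC sE; case: ifP => _; rewrite ?mulr1 ?mul1r ?mulN1r ?opprK.
    - rewrite !mul0r !addr0 !mulr0 !expR0; case: ifP => _; lra.
  rewrite -expR_sum -mulr_sumr sum_pair_coef ler_expR.
  have -> : \sum_i \sum_(j | j != i) d i j = n%:R - 1.
    rewrite (bigD1 i0) //= [X in _ + X]big1 ?addr0 => [|i ni].
      rewrite (eq_bigr (fun=> 1)) => [|j _]; last by rewrite /d eqxx mulr1.
      rewrite sumr_const.
      have := cardC1 i0; rewrite card_ord => ->.
      by rewrite -subn1 natrB.
    by rewrite big1 // => j _; rewrite /d (negbTE ni) mul0r.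
  by rewrite mulNr.
congr (_ * _); apply: eq_bigr => V _; congr (_ * expR _).
rewrite -pair_sum (row_sum i0 _ (fun j => - 2^-1 * (s i0 * s j))) mulr_sumr.
by apply: eq_bigr => j _; rewrite /llr_mx /spins /sigma0 /s /=; ring.
Qed.


Definition mean_c1 : R := t * (mean_same p q - mean_diff p q) / 2.
Definition mean_c2 : R := t * (mean_same p q + mean_diff p q) / 2.

Lemma mean_c2_lt : `|mean_c2| < mean_c1.
Proof.
have := mean_same_gt0 p01 q01 pq; have := mean_diff_lt0 p01 q01 pq => hd hs.
rewrite /mean_c1 /mean_c2 ltr_norml -mulNr -mulrN !ltr_pM2r ?invr_gt0 // !ltr_pM2l //.
by apply/andP; split; lra.
Qed.

Lemma mean_mxE (w : outcome n) i j : i != j ->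
  mean_mx (spins w) l mean_c1 mean_c2 i j =
  alpha * (if sigma0 w i == sigma0 w j then mean_same p q else mean_diff p q) :> R.
Proof.
move=> ij; rewrite /mean_mx /mean_c1 /mean_c2 /spins spin_addb /reveal_prob.
rewrite -[sigma0 w i == sigma0 w j]negbK -negb_eqb -addNb.
by case: (sigma0 w i); case: (sigma0 w j); rewrite /= /spin ?expr0 ?expr1; field; rewrite gt_eqF.
Qed.

(** The union over 4^n pairs of sign vectors costs an exponent below 2 n, while the deviation leaves
    a gain [theta * k / 2 * n * l], which wins because [l] is large. In the constant 3, two units
    pay for the union and the third leaves the rate, through [l <= n]. *)
Lemma cut_bad (B k theta : R) : 0 < k -> 0 < theta ->
  `|llr_present p q| <= B -> `|llr_absent p q| <= B -> B * (2 * theta) <= 1 / 2 ->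
  `|mean_c2| < mean_c1 ->
  4 * t * B ^+ 2 * theta <= k / 2 ->
  3 + 2 * mean_c1 * theta <= theta * k / 2 * l ->
  csbm_pr p q alpha (fun w : outcome n => `[< exists s r : 'I_n -> bool,
    k * (n%:R * l) < \sum_i \sum_j spin (s i) * spin (r j) *
       (llr_mx p q w i j - mean_mx (spins w) l mean_c1 mean_c2 i j) >]) <=
  expR (- l).
Proof.
move=> k0 th0 w1B w0B Bth c12 hth hl.
have c10 : 0 < mean_c1 by apply: le_lt_trans c12.
apply: le_trans (_ : \sum_(sr : {ffun 'I_n -> bool} * {ffun 'I_n -> bool})
  expR (2 * mean_c1 * theta * l + theta * (k / 2) * (n%:R * l) - theta * k * (n%:R * l)) <= _).
  apply: (csbm_pr_chernoff_le p01 q01 alpha01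
    (X := fun (sr : {ffun 'I_n -> bool} * {ffun 'I_n -> bool}) w =>
     theta * (\sum_i \sum_j spin (sr.1 i) * spin (sr.2 j) *
       (llr_mx p q w i j - mean_mx (spins w) l mean_c1 mean_c2 i j)) - theta * k * (n%:R * l))).
    move=> w /asboolP[s [r h]]; exists ([ffun i => s i], [ffun i => r i]) => //.
    rewrite subr_ge0 -mulrA ler_pM2l //; apply: le_trans (ltW h) _.
    by apply: ler_sum => i _; apply: ler_sum => j _; rewrite !ffunE.
  case=> s r _; apply: csbm_ex_shift; apply: csbm_ex_le_labels => // sigma.
  (* The mean matrix depends on the labels only; edges and reveal indicators of [w0] are
     placeholders. *)
  pose w0 : outcome n := (sigma, [ffun=> false], [ffun=> false]).
  pose N := mean_mx (spins w0) l mean_c1 mean_c2.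
  pose c (i j : 'I_n) := theta * (spin (s i) * spin (r j)) : R.
  pose M := \sum_i \sum_j N i j * c i j.
  pose m e := alpha * (if same_label sigma e then mean_same p q else mean_diff p q).
  have c_abs i j : `|c i j| <= theta.
    by rewrite /c !normrM !normr_spin !mulr1 gtr0_norm.
  rewrite (eq_bigr (fun E : {ffun vpair n -> bool} => expR (- M) * (bern_ffun (edge_rate p q sigma) E *
    \sum_V bern_ffun (fun=> alpha) V * expR (\sum_e llr p q E V e * pair_coef c e)))) => [|E _].
    rewrite -mulr_sumr llr_mgf.
    apply: le_trans (_ : expR (- M) * \prod_e expR (m e * pair_coef c e +
       alpha * (2 * B ^+ 2 * (2 * theta * pair_coef (fun _ _ => theta) e))) <= _).
      rewrite ler_wpM2l ?expR_ge0 //.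
      apply: ler_prod => e _; apply/andP; split.
        have /andP[r0 r1] := edge_rate01 p01 q01 sigma e.
        have /andP[a0 a1] := alpha01.
        by rewrite addr_ge0 ?subr_ge0 // mulr_ge0 // addr_ge0 // mulr_ge0 ?expR_ge0 ?subr_ge0.
      have /andP[a0 _] := alpha01.
      have [a [b [ab ev]]] := vpairP e.
      have xth : `|pair_coef c e| <= 2 * theta.
        rewrite (pair_coef2 _ ab ev); apply: le_trans (ler_normD _ _) _.
        have := c_abs a b; have := c_abs b a; lra.
      have B0 : 0 <= B by apply: le_trans w1B.
      apply: le_trans (llr_mgf_quad (B := B) a0 (edge_rate01 p01 q01 sigma e) w1B w0B _) _.
        by apply: le_trans Bth; rewrite ler_wpM2l.
      rewrite ler_expR mulrDr lerD //.
        rewrite /m /edge_rate /mean_same /mean_diff le_eqVlt; apply/orP; left; apply/eqP.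
        by case: ifP => _; ring.
      rewrite ler_wpM2l // ler_wpM2l ?mulr_ge0 ?sqr_ge0 //.
      have -> : pair_coef (fun _ _ : 'I_n => theta) e = theta + theta := pair_coef2 _ ab ev.
      rewrite -real_normK ?num_real // expr2.
      apply: le_trans (_ : (2 * theta) * (2 * theta) <= _); first by apply: ler_pM.
      by rewrite le_eqVlt; apply/orP; left; apply/eqP; ring.
    rewrite -expR_sum -expRD ler_expR big_split /=.
    rewrite -pair_sum -!mulr_sumr.
    have S2 : alpha * (2 * B ^+ 2 * (2 * theta * \sum_e pair_coef (fun _ _ : 'I_n => theta) e)) <=
        theta * (k / 2) * (n%:R * l).
      have th0' := ltW th0; have /andP[a0 _] := alpha01.
      apply: le_trans (_ : alpha * (2 * B ^+ 2 * (2 * theta * (theta * (n%:R * n%:R)))) <= _).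
        apply: ler_wpM2l => //; apply: ler_wpM2l; first by rewrite mulr_ge0 ?sqr_ge0.
        apply: ler_wpM2l; first by rewrite mulr_ge0.
        apply: le_trans (sum_pair_coef_le (fun _ _ => th0')) _.
        rewrite !sumr_const card_ord -[leLHS]mulr_natl -[theta *+ n]mulr_natl; lra.
      have -> : alpha * (2 * B ^+ 2 * (2 * theta * (theta * (n%:R * n%:R)))) =
        (alpha * n%:R) * n%:R * theta * (4 * B ^+ 2 * theta) by ring.
      rewrite alpha_n.
      have -> : t * l * n%:R * theta * (4 * B ^+ 2 * theta) =
        theta * (n%:R * l) * (4 * t * B ^+ 2 * theta) by ring.
      have -> : theta * (k / 2) * (n%:R * l) = theta * (n%:R * l) * (k / 2) by ring.
      by rewrite ler_wpM2l // !mulr_ge0 // ltW.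
    (* Off the diagonal the means cancel exactly by [mean_mxE]; what remains are [n] diagonal
       entries of size at most [2 * mean_c1 * l / n]. *)
    have S1 : - M + \sum_i \sum_j pairval m i j * c i j <= 2 * mean_c1 * theta * l.
      rewrite /M -sumrN -big_split /=.
      apply: le_trans (_ : \sum_(i < n) 2 * mean_c1 * theta * (l / n%:R) <= _); last first.
        rewrite sumr_const card_ord -[leLHS]mulr_natl le_eqVlt; apply/orP; left; apply/eqP.
        by field; rewrite gt_eqF.
      apply: ler_sum => i _; rewrite -sumrN -big_split /= (bigD1 i) //= big1 => [|j ji].
        rewrite pairval_diag mul0r !addr0; apply: le_trans (ler_norm _) _.
        rewrite normrN normrM mulrC -mulrA mulrC.
        have Nii : `|N i i| <= 2 * mean_c1 * (l / n%:R).
          have ln0 : 0 <= l / n%:R by rewrite divr_ge0 // ltW.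
          rewrite /N /mean_mx /spins spin_sq mulr1 normrM ger0_norm // mulrC ler_wpM2r //.
          apply: le_trans (ler_normD _ _) _; rewrite (gtr0_norm c10).
          by move: (ltW c12); lra.
        have : `|c i i| * `|N i i| <= theta * (2 * mean_c1 * (l / n%:R)) by apply: ler_pM.
        rewrite mulrC; lra.
      have ij : i != j by rewrite eq_sym.
      rewrite /pairval /N (mean_mxE w0 ij).
      case: insubP => [e _ ev|]; last by rewrite cards2 (eq_sym i) ji.
      by rewrite /m (same_label2 sigma ev) /w0 /sigma0 /= addNr.
    lra.
  rewrite mulrCA; congr (_ * _); rewrite mulr_sumr; apply: eq_bigr => V _.
  rewrite mulrCA; congr (_ * _); rewrite -expRD; congr expR.
  rewrite -pair_sum /M -sumrN -big_split mulr_sumr; apply: eq_bigr => i _ /=.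
  rewrite -sumrN -big_split mulr_sumr; apply: eq_bigr => j _ /=.
  by rewrite /c /N /llr_mx /spins /sigma0 /=; ring.
rewrite sumr_const card_prod card_ffun card_bool card_ord -[leLHS]mulr_natl natrM natrX.
have two : (2 : R) ^+ n <= expR n%:R.
  have h : (2 : R) <= expR 1 by have := @expR_ge1Dx R 1; lra.
  by rewrite -[n%:R]mulr1 expRM_natl lerXn2r ?nnegrE ?expR_ge0.
set y := expR (_ - _); apply: le_trans (_ : expR n%:R * expR n%:R * y <= _).
  apply: ler_wpM2r; first exact: expR_ge0.
  by apply: ler_pM; rewrite ?exprn_ge0.
rewrite /y -!expRD ler_expR.
have h1 : n%:R * (3 + 2 * mean_c1 * theta) <= n%:R * (theta * k / 2 * l).
  by rewrite ler_wpM2l // ltW.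
have ct : 0 <= mean_c1 * theta by apply: mulr_ge0; exact: ltW.
have h2 := ler_wpM2l ct l_le_n.
have h3 := l_le_n.
lra.
Qed.


(** The inner product is the average of [n] independent spins; the Boolean index runs over the two
    signs of the deviation. The bound is exponential in [n] and is weakened to a power of [n] to
    match the other events. *)
Lemma balance_bad (k theta : R) : 0 < k -> 0 < theta <= 1 / 2 -> 4 * theta <= k ->
  csbm_pr p q alpha (fun w : outcome n =>
    `[< k < `|dot uniform_vec (label_vec (spins w))| >]) <=
  2 * expR (- (theta * k / 2) * l).
Proof.
move=> k0 /andP[th0 th1] thk.
have dE (w : outcome n) : dot uniform_vec (label_vec (spins w)) = (\sum_i spins w i) / n%:R :> R.
  rewrite /dot mulr_suml; apply: eq_bigr => i _; rewrite /uniform_vec /label_vec.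
  by rewrite mulrCA -expr2 exprVn sqr_sqrtr // ltW.
apply: le_trans (_ : \sum_(b : bool) expR (2 * theta ^+ 2 * n%:R - theta * k * n%:R) <= _).
  apply: (csbm_pr_chernoff_le p01 q01 alpha01 (X := fun (b : bool) w =>
    theta * spin b * (\sum_i spins w i) - theta * k * n%:R)).
    move=> w /asboolP; rewrite dE => h; exists (\sum_i (spins w i : R) < 0) => //.
    rewrite -mulrA spin_ltr0 subr_ge0 -mulrA ler_pM2l // ltW //.
    by rewrite -ltr_pdivlMr // -[X in _ / X](gtr0_norm nR) -normfV -normrM.
  move=> b _; apply: csbm_ex_shift.
  rewrite csbm_exE.
  rewrite (eq_bigr (fun sigma : {ffun 'I_n -> bool} => bern_ffun (fun=> 2^-1) sigma *
     \prod_i expR (theta * spin b * spin (sigma i)))) => [|sigma _].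
    rewrite (sum_bern_ffun (fun=> 2^-1) (fun i x => expR (theta * spin b * spin x))).
    apply: le_trans (_ : \prod_(i < n) expR (2 * theta ^+ 2) <= _); last first.
      by rewrite prodr_const card_ord -expRM_natr.
    apply: ler_prod => i _; apply/andP; split.
      by rewrite addr_ge0 // mulr_ge0 ?expR_ge0 //; lra.
    set x := theta * spin b; rewrite /spin expr0 expr1 mulr1 mulrN1.
    have xa : `|x| = theta by rewrite /x normrM normr_spin mulr1 gtr0_norm.
    have x2 : x ^+ 2 = theta ^+ 2 by rewrite -real_normK ?num_real // xa.
    have h1 : expR x <= 1 + x + 2 * x ^+ 2 by apply: expR_le_quad; rewrite xa.
    have h2 : expR (- x) <= 1 + - x + 2 * (- x) ^+ 2.
      by apply: expR_le_quad; rewrite normrN xa.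
    rewrite sqrrN in h2; rewrite x2 in h1 h2.
    have := expR_ge1Dx (2 * theta ^+ 2); lra.
  congr (_ * _).
  rewrite -expR_sum -mulr_sumr.
  by do 2!apply: bern_average_const => ?.
rewrite big_bool /= -mulr2n -[leLHS]mulr_natl ler_pM2l // ler_expR.
have h : theta * (4 * theta) * n%:R <= theta * k * n%:R.
  by rewrite ler_wpM2r ?(ltW nR) // ler_wpM2l // ltW.
have h2 : theta * k * l <= theta * k * n%:R.
  by rewrite ler_wpM2l // mulr_ge0 // ltW.
lra.
Qed.

End BadEvents.

(** * Spectral recovery *)

Lemma large_n (R : realType) (t L : R) : 0 < t ->
  (\forall n \near \oo, [/\ (0 < n)%N, 0 <= reveal_prob t n <= 1 & L <= ln n%:R])%classic.
Proof.
move=> t0; near=> n.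
have n1 : 1 <= n%:R :> R by near: n; exact: nbhs_infty_ger.
have n0 : 0 < n%:R :> R by apply: lt_le_trans n1.
split.
- by rewrite -(ltr0n R).
- have l0 : 0 <= ln n%:R :> R by apply: ln_ge0.
  rewrite /reveal_prob divr_ge0 ?mulr_ge0 ?(ltW t0) ?(ltW n0) //= ler_pdivrMr // mul1r.
  set r : R := Num.sqrt n%:R.
  have r0 : 0 < r by rewrite sqrtr_gt0.
  have r2 : r ^+ 2 = n%:R by rewrite sqr_sqrtr // ltW.
  have tr : 2 * t <= r.
    have t2 : 0 <= 2 * t by rewrite mulr_ge0 // ltW.
    rewrite -(ger0_norm t2) -sqrtr_sqr ler_sqrt //.
    by near: n; exact: nbhs_infty_ger.
  have lnr : ln n%:R = 2 * ln r by rewrite -r2 lnXn // -[LHS]mulr_natl.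
  have h : ln r <= r by apply: ltW; apply: ln_sublinear.
  rewrite lnr -r2 expr2; apply: le_trans (_ : (2 * t) * r <= _).
    by rewrite mulrA (mulrC t) ler_wpM2l // mulr_ge0 // ltW.
  by rewrite ler_wpM2r // ltW.
- rewrite -(expRK L) ler_ln ?posrE ?expR_gt0 //.
  by near: n; exact: nbhs_infty_ger.
Unshelve. all: by end_near. Qed.

Lemma csbm_pr_cover (R : realType) (p q alpha : R) n (s : seq (pred (outcome n))) :
  0 < p < 1 -> 0 < q < 1 -> 0 <= alpha <= 1 ->
  (forall w, has (fun A => A w) s) ->
  1 <= \sum_(A <- s) csbm_pr p q alpha A.
Proof.
move=> p01 q01 a01 cover.
have -> : \sum_(A <- s) csbm_pr p q alpha A =
    csbm_ex p q alpha (fun w => \sum_(A <- s) (A w)%:R).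
  elim: s {cover} => [|A s IH].
    by rewrite big_nil /csbm_ex big1 // => w _; rewrite big_nil mulr0.
  rewrite big_cons IH csbm_pr_ex -big_split; apply: eq_bigr => w _ /=.
  by rewrite big_cons mulrDr.
rewrite -[leLHS](csbm_ex1 p q alpha n); apply: le_csbm_ex => // w.
move: {cover} (cover w); elim: s => //= A s IH; rewrite big_cons; case: (A w) => /=; last by rewrite add0r.
by move=> _; rewrite lerDl; apply: sumr_ge0.
Qed.

Lemma whp_of_bound (R : realType) (p q t : R) (A : forall n, pred (outcome n)) (K c L : R) :
  0 < p < 1 -> 0 < q < 1 -> 0 < t -> 0 < c ->
  (forall n, (0 < n)%N -> 0 <= reveal_prob t n <= 1 -> L <= ln n%:R ->
     1 <= csbm_pr p q (reveal_prob t n) (@A n) + K * expR (- c * ln n%:R)) ->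
  with_high_probability p q t A.
Proof.
move=> p01 q01 t0 c0 bound; rewrite /with_high_probability.
pose K' := `|K| + 1.
have K0 : 0 < K' by rewrite ltr_wpDl.
have KK : K <= K' by apply: le_trans (ler_norm _) _; rewrite lerDl.
apply/cvgrPdist_le => e e0.
have := @large_n R t (Num.max L (ln (K' / e) / c)) t0; apply: filterS => n [n0 a01].
rewrite ge_max => /andP[Ll el].
have A1 := csbm_pr_le1 p01 q01 a01 (@A n).
rewrite ger0_norm ?subr_ge0 //; have := bound n n0 a01 Ll => h.
apply: le_trans (_ : K * expR (- c * ln n%:R) <= _); first by lra.
apply: le_trans (_ : K' * expR (- c * ln n%:R) <= _).
  by rewrite ler_wpM2r // expR_ge0.
rewrite mulrC -ler_pdivlMr // -[e / K']lnK ?posrE ?divr_gt0 // ler_expR.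
rewrite -[e / K']invf_div lnV ?posrE ?divr_gt0 // mulNr lerN2.
by rewrite -ler_pdivrMl // mulrC.
Qed.

Lemma whp_sub (R : realType) (p q t : R) (A B : forall n, pred (outcome n)) :
  0 < p < 1 -> 0 < q < 1 -> 0 < t ->
  (forall n w, @A n w -> @B n w) ->
  with_high_probability p q t A -> with_high_probability p q t B.
Proof.
move=> p01 q01 t0 AB; rewrite /with_high_probability => hA.
apply: (squeeze_cvgr (h := fun=> 1) (f := fun n => csbm_pr p q (reveal_prob t n) (@A n))) => //.
  have := @large_n R t 0 t0; apply: filterS => n [n0 a01 _].
  rewrite csbm_pr_le1 // andbT !csbm_pr_ex; apply: le_csbm_ex => // w.
  by have := @AB n w; case: (A n w); case: (B n w) => // /(_ isT).
exact: cvg_cst.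
Qed.

Lemma llr_mx_censor (R : realType) (p q : R) n k (w : outcome n) i j :
  llr_mx p q (censor_row k w) i j = erase k (llr_mx p q w) i j.
Proof.
rewrite /llr_mx /erase /pairval; case: insubP => [e _ ev|_]; last by case: ifP.
rewrite /llr /= !ffunE ev !inE (eq_sym k i) (eq_sym k j).
by case: ((i == k) || (j == k)).
Qed.

Lemma signed_adjacency_llr (R : realType) (p q : R) n (w : outcome n) i j :
  0 < p < 1 -> 0 < q < 1 -> p != q ->
  signed_adjacency (y_pq p q) (observe w) i j =
  (ln (p / q))^-1 * llr_mx p q w i j.
Proof.
move=> /andP[p0 p1] /andP[q0 q1] pq.
have lnpq : ln (p / q) != 0.
  rewrite ln_eq0 ?divr_gt0 //; apply: contra pq => /eqP h.
  by rewrite -(divfK (lt0r_neq0 q0) p) h mul1r.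
have p1' : 0 < 1 - p by rewrite subr_gt0.
have q1' : 0 < 1 - q by rewrite subr_gt0.
rewrite mxE /llr_mx /pairval; case: insub => [e|]; last by rewrite mulr0.
rewrite /llr /observe ffunE; case: (w.2 e) => /=; last by rewrite mulr0.
case: (w.1.2 e) => /=; first by rewrite /llr_present mulVf.
rewrite /y_pq /llr_absent -[(1 - q) / (1 - p)]invf_div lnV ?posrE ?divr_gt0 //.
by rewrite mulNr opprK mulrC.
Qed.

Lemma top_pair_scale (R : realType) n (M : 'M[R]_n) (L : 'I_n -> 'I_n -> R) (c : R)
    (u : 'rV[R]_n) :
  0 < c -> (forall i j, M i j = c * L i j) -> (forall i j, L i j = L j i) ->
  top_unit_eigenvector M u -> exists lam, top_pair L (u 0) lam.
Proof.
move=> c0 ML sL top; have sM : M^T = M by apply/matrixP => i j; rewrite !mxE !ML sL.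
have [u1 [lam [Mu uR]]] := top_unit_eigenvectorP sM top.
have MLx x : mulmv M x =1 (fun i => c * mulmv L x i).
  by move=> i; rewrite /mulmv mulr_sumr; apply: eq_bigr => j _; rewrite ML mulrA.
exists (lam / c); split=> //.
  move=> i; have := Mu i; rewrite MLx => h.
  by rewrite mulrAC -h mulrC mulrA mulVf ?mul1r // gt_eqF.
move=> x; have := uR x; rewrite (eq_dot (fun=> erefl) (MLx x)) dotZr => h.
by rewrite mulrAC ler_pdivlMr // mulrC.
Qed.

Lemma not_asbool (P : Prop) : ~~ `[< P >] -> ~ P.
Proof. by move=> /negP nP hP; apply: nP; exact: asboolT. Qed.

Lemma revealed01 (R : realType) n (w : outcome n) i j : 0 <= (revealed w i j : R) <= 1.
Proof.
rewrite /revealed /pairval; case: insub => [e|]; last by rewrite lexx ler01.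
by case: (w.2 e); rewrite ?lexx ler01.
Qed.

Lemma llr_mx_le (R : realType) (p q : R) n (w : outcome n) i j :
  `|llr_mx p q w i j| <= (`|llr_present p q| + `|llr_absent p q|) * revealed w i j.
Proof.
rewrite /llr_mx /revealed /pairval; case: insub => [e|]; last by rewrite normr0 mulr0.
rewrite /llr; case: (w.2 e); last by rewrite normr0 mulr0.
by rewrite mulr1; case: (w.1.2 e); rewrite ?lerDl ?lerDr.
Qed.

(* The deviation of a unit vector from the closest of [z] and [- z], scaled to
   have entries in [0, 1]; junk value 0 when the vector is not close to them. *)
Definition scaled_deviation {R : realType} {n : nat} (rho : R) (v z : 'I_n -> R)
    (j : 'I_n) : R :=
  let w i := v i - spin (dot v z < 0) * z i in
  if 1 - dot v z ^+ 2 <= rho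
  then `|w j| / (\big[Num.max/0]_i `|w i| + (Num.sqrt n%:R)^-1) else 0.

(** For a close vector the squared norm of the deviation is 2 - 2 |<v,z>| <= 2 rho <= eps^2, hence
    its l^1 norm is at most eps sqrt n; the denominator is at least 1 / sqrt n, which gives eps
    n. *)
Lemma scaled_deviation_bounds (R : realType) n (rho eps : R) (v z : 'I_n -> R) :
  (0 < n)%N -> 0 < eps -> rho <= eps ^+ 2 / 2 -> dot v v = 1 -> dot z z = 1 ->
  (forall j, 0 <= scaled_deviation rho v z j <= 1) /\
  \sum_j scaled_deviation rho v z j <= eps * n%:R.
Proof.
move=> n0 eps0 rhoe v1 z1.
have nR : 0 < n%:R :> R by rewrite ltr0n.
rewrite /scaled_deviation; set S := spin (dot v z < 0).
set m := \big[Num.max/0]_i _; set rn := Num.sqrt n%:R : R.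
have rn0 : 0 < rn by rewrite sqrtr_gt0.
have m0 : 0 <= m by apply: bigmax_ge_id.
have mr0 : 0 < m + rn^-1 by rewrite ltr_wpDl // invr_gt0.
case cl : (1 - dot v z ^+ 2 <= rho); last first.
  split=> [j|]; first by rewrite lexx ler01.
  by rewrite big1 // mulr_ge0 // ltW.
split=> [j|].
  rewrite divr_ge0 ?(ltW mr0) //= ler_pdivrMr // mul1r.
  have h : `|v j - S * z j| <= m by apply: (le_bigmax _ (fun i => `|v i - S * z i|)).
  by apply: le_trans h _; rewrite lerDl invr_ge0 ltW.
rewrite -mulr_suml ler_pdivrMr //.
apply: le_trans (sum_norm_le_sqrt _) _; rewrite -/rn.
have dw : dot (fun i => v i - S * z i) (fun i => v i - S * z i) <= eps ^+ 2.
  have we : (fun i => v i - S * z i) =1 (fun i => v i + - S * z i).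
    by move=> i; rewrite mulNr.
  rewrite (eq_dot we we) dotD2 dotZl !dotZr z1 v1.
  have SS : S * S = 1 by exact: spin_sq.
  have Sb : S * dot v z = `|dot v z| by exact: spin_ltr0.
  have b1 : `|dot v z| ^+ 2 <= `|dot v z|.
    rewrite expr2 ler_piMl // -(@expr_le1 _ 2%N) // real_normK ?num_real //.
    exact: unit_dot_le1.
  rewrite real_normK ?num_real // in b1.
  have -> : 1 + 2 * (- S * dot v z) + - S * (- S * 1) = 1 - 2 * (S * dot v z) + S * S by ring.
  rewrite SS Sb; lra.
apply: le_trans (_ : rn * eps <= _).
  by rewrite ler_pM2l // -[leRHS](gtr0_norm eps0) -sqrtr_sqr ler_wsqrtr.
have -> : rn * eps = eps * n%:R * rn^-1.
  by rewrite -(sqr_sqrtr (ltW nR)) -/rn; field; rewrite gt_eqF.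
by rewrite ler_wpM2l ?mulr_ge0 ?(ltW eps0) ?(ltW nR) // lerDr.
Qed.

Section SpectralRecovery.
Context {R : realType} (p q t : R).
Hypothesis p01 : 0 < p < 1.
Hypothesis q01 : 0 < q < 1.
Hypothesis pq : p != q.
Hypothesis t0 : 0 < t.
Hypothesis t_gt_tc : t_c p q < t.
Variables (M : forall n, observation n -> 'M[R]_n) (cc : R).
Hypothesis cc0 : 0 < cc.
Hypothesis ME : forall n (w : outcome n) i j,
  M (observe w) i j = cc * llr_mx p q w i j.

Let H := hellinger_gap p q.
Let H0 : 0 < H. Proof. exact: hellinger_gap_gt0. Qed.
Let tH1 : 0 < t * H - 1.
Proof.
move: t_gt_tc; rewrite t_cE // -/H => h.
by rewrite subr_gt0 -ltr_pdivrMr // mul1r.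
Qed.

Theorem spectral_separation : exists2 eta : R, 0 < eta &
  forall u1 : forall n, observation n -> 'rV[R]_n,
  top_eigenvector_choice M u1 ->
  with_high_probability p q t (fun n (w : outcome n) =>
    [exists s : bool, forall i : 'I_n,
       eta <= Num.sqrt n%:R * (spin s * spin (sigma0 w i) * u1 n (observe w) 0 i)]).
Proof.
have c12 := mean_c2_lt p01 q01 t0 pq.
set c1 := mean_c1 p q t in c12; set c2 := mean_c2 p q t in c12.
have c10 : 0 < c1 by apply: le_lt_trans c12.
pose B := `|llr_present p q| + `|llr_absent p q|.
have B0 : 0 <= B by rewrite addr_ge0.
pose D := t * expR 1 + 2.
have D0 : 0 <= D by rewrite addr_ge0 // mulr_ge0 ?expR_ge0 // ltW.
pose m := t * H - 1.
have m0 : 0 < m by exact: tH1.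
have [eta [delta [eta0 delta0 cons]]] := deterministic_bound c12 B0 D0 m0.
pose th6 := 3 / delta.
have th60 : 0 < th6 by rewrite divr_gt0.
pose X6 := t * expR th6 * th6.
have X60 : 0 < X6 by do ?apply: mulr_gt0 => //; exact: expR_gt0.
(* Turns the smallness condition of [row_resample_bad] into an equality; [rho] is then taken below
   [eps6 ^+ 2 / 2], as [scaled_deviation_bounds] requires. *)
pose eps6 := X6^-1.
have eps60 : 0 < eps6 by rewrite invr_gt0.
have rho00 : 0 < eps6 ^+ 2 / 2 by rewrite divr_gt0 // exprn_gt0.
have [rho [e [kap [l0 [/andP[rhop rho_le] e01 kap0 l00 det]]]]] := cons _ rho00.
have /andP[e0 e1] := e01.
pose th3 := 3 / e ^+ 2.
have th30 : 0 < th3 by rewrite divr_gt0 // exprn_gt0.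
pose X3 := t * expR (2 * th3) * th3.
have X30 : 0 < X3 by do ?apply: mulr_gt0 => //; exact: expR_gt0.
pose d := Num.min 1 X3^-1.
have d0 : 0 < d by rewrite lt_min ltr01 invr_gt0.
have d1 : d <= 1 by rewrite ge_min lexx.
have dX : X3 * d ^+ 2 <= 1.
  apply: le_trans (_ : X3 * d <= _).
    by rewrite ler_pM2l // expr2 ler_piMr // ltW.
  apply: le_trans (_ : X3 * X3^-1 <= _); last by rewrite divff ?gt_eqF.
  by rewrite ler_pM2l // ge_min lexx orbT.
pose k := e ^+ 3 * d ^+ 2.
have k0 : 0 < k by rewrite mulr_gt0 // exprn_gt0.
pose th4 := Num.min (1 / (4 * (B + 1))) (k / (8 * t * (B ^+ 2 + 1))).
have B10 : 0 < B + 1 by rewrite ltr_wpDl.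
have B20 : 0 < B ^+ 2 + 1 by rewrite ltr_wpDl ?sqr_ge0.
have th40 : 0 < th4 by rewrite lt_min !divr_gt0 // !mulr_gt0.
have Bth4 : B * (2 * th4) <= 1 / 2.
  apply: le_trans (_ : (B + 1) * (2 * (1 / (4 * (B + 1)))) <= _).
    apply: ler_pM => //; rewrite ?mulr_ge0 ?(ltW th40) // ?lerDl //.
    by rewrite ler_pM2l // ge_min lexx.
  by rewrite le_eqVlt; apply/orP; left; apply/eqP; field; rewrite gt_eqF.
have kth4 : 4 * t * B ^+ 2 * th4 <= k / 2.
  apply: le_trans (_ : 4 * t * (B ^+ 2 + 1) * (k / (8 * t * (B ^+ 2 + 1))) <= _).
    apply: ler_pM; rewrite ?mulr_ge0 ?sqr_ge0 ?(ltW th40) ?(ltW t0) //.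
      by rewrite ler_wpM2l ?mulr_ge0 ?(ltW t0) // lerDl.
    by rewrite ge_min lexx orbT.
  by rewrite le_eqVlt; apply/orP; left; apply/eqP; field; rewrite !gt_eqF.
pose th1 := Num.min (1 / 2) (kap / 4).
have th10 : 0 < th1 by rewrite lt_min !divr_gt0.
have th1h : th1 <= 1 / 2 by rewrite ge_min lexx.
have th1k : 4 * th1 <= kap.
  apply: le_trans (_ : 4 * (kap / 4) <= _); last by rewrite mulrC divfK ?pnatr_eq0.
  by rewrite ler_pM2l // ge_min lexx orbT.
have thk4 : 0 < th4 * k / 2 by rewrite divr_gt0 // mulr_gt0.
pose L := Num.max l0 ((3 + 2 * c1 * th4) / (th4 * k / 2)).
pose c := Num.min 1 (Num.min (m / 2) (th1 * kap / 2)).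
have c0 : 0 < c by rewrite !lt_min ltr01 !divr_gt0 // mulr_gt0.
exists eta => // u1 top.
(* The degree, row and cut events contribute 1 each and the balance event 2; [expR 1] comes from
   sparsity and [expR (t * H)] from the margin. *)
apply: (whp_of_bound (K := 5 + expR 1 + expR (t * H)) (c := c) (L := L)) => //.
move=> n n0 a01; rewrite ge_max => /andP[ll0 ll4].
set l := ln n%:R in ll0 ll4 *.
have l_ge0 : 0 <= l by apply: le_trans ll0; apply: ltW.
have {}ll4 : 3 + 2 * c1 * th4 <= th4 * k / 2 * l.
  by rewrite -ler_pdivrMl // [leLHS]mulrC.
pose z (w : outcome n) : 'I_n -> R := label_vec (spins w).
(* The dependence on the row arises when [row_resample_bad] evaluates this at [censor_row k w];
   censoring does not affect the labels, hence not [z]. *)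
pose dev (_ : 'I_n) (w : outcome n) := scaled_deviation rho (u1 n (observe w) 0) (z w).
have spin2 (w : outcome n) i : spins w i ^+ 2 = 1 :> R by rewrite expr2 spin_sq.
have z1 (w : outcome n) : dot (z w) (z w) = 1 by exact: dot_label_vector.
have sLl (w : outcome n) i j : llr_mx p q w i j = llr_mx p q w j i :> R by exact: pairval_sym.
have topL (w : outcome n) : exists lam, top_pair (llr_mx p q w) (u1 n (observe w) 0) lam.
  exact: (top_pair_scale cc0 (ME w) (sLl w) (top n (observe w) n0)).
have devP (w : outcome n) := scaled_deviation_bounds n0 eps60 rho_le
  (let: ex_intro _ (And3 h _ _) := topL w in h) (z1 w).
have w1B : `|llr_present p q| <= B by rewrite lerDl.
have w0B : `|llr_absent p q| <= B by rewrite lerDr.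
have b1 := degree_bad p01 q01 n0 a01 (erefl D).
have b2 := sparse_bad p01 q01 t0 n0 a01 e01 (d := d) (ltac:(by rewrite d0)) (erefl th3) dX.
have b3 := row_resample_bad p01 q01 n0 a01 (h := dev) delta0
  (fun _ w => (devP w).1) (fun _ w => (devP w).2) (erefl th6)
  (ltac:(by rewrite divff ?gt_eqF)).
have b4 := margin_bad p01 q01 t0 n0 a01 pq (erefl m).
have b5 := cut_bad p01 q01 n0 a01 k0 th40 w1B w0B Bth4 c12 kth4 ll4.
have b6 := balance_bad p01 q01 n0 a01 kap0 (ltac:(by rewrite th10) : 0 < th1 <= 1 / 2) th1k.
set A := (fun w : outcome n => _).
move: b1; set E1 := (X in csbm_pr _ _ _ X <= _) => b1.
move: b2; set E2 := (X in csbm_pr _ _ _ X <= _) => b2.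
move: b3; set E3 := (X in csbm_pr _ _ _ X <= _) => b3.
move: b4; set E4 := (X in csbm_pr _ _ _ X <= _) => b4.
move: b5; set E5 := (X in csbm_pr _ _ _ X <= _) => b5.
move: b6; set E6 := (X in csbm_pr _ _ _ X <= _) => b6.
have cover (w : outcome n) : has (fun A => A w) [:: A; E1; E2; E3; E4; E5; E6].
  have hasE (P0 P1 P2 P3 P4 P5 P6 : pred (outcome n)) :
      [|| P0 w, P1 w, P2 w, P3 w, P4 w, P5 w | P6 w] ->
      has (fun A => A w) [:: P0; P1; P2; P3; P4; P5; P6] by rewrite /= orbF.
  apply: hasE; apply: contraT.
  case/norP=> nA /norP[/not_asbool e_1 /norP[/not_asbool e_2 /norP[/not_asbool e_3
    /norP[/not_asbool e_4 /norP[/not_asbool e_5 /not_asbool e_6]]]]].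
  case/negP: nA; rewrite /A.
  have [lam topu] := topL w.
  have topv k' : exists mu, top_pair (erase k' (llr_mx p q w))
      (u1 n (observe (censor_row k' w)) 0) mu.
    apply: (top_pair_scale cc0 _ _ (top n (observe (censor_row k' w)) n0)).
      by move=> i j; rewrite ME llr_mx_censor.
    by apply: erase_sym; exact: sLl.
  pose mu k' := xget 0 [set mu | top_pair (erase k' (llr_mx p q w))
      (u1 n (observe (censor_row k' w)) 0) mu]%classic.
  have muP k' : top_pair (erase k' (llr_mx p q w)) (u1 n (observe (censor_row k' w)) 0) (mu k').
    have [x hx] := topv k'.
    exact: (@xgetPex _ 0 [set mu | top_pair _ _ mu]%classic (ex_intro _ x hx)).
  have sep := det n (spins w) l d (llr_mx p q w) (revealed w) (u1 n (observe w) 0) lam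
    (fun k' => u1 n (observe (censor_row k' w)) 0) mu n0 (spin2 w) ll0 _ (sLl w)
    (pairval_diag _) (pairval_sym _) (@revealed01 R n w) (llr_mx_le p q w) _ _ _ _ topu muP _ _.
  apply/existsP; exists (dot (u1 n (observe w) 0) (label_vec (spins w)) < 0).
  apply/forallP => i; apply: sep.
  - by rewrite d0.
  - by move=> i'; rewrite leNgt; apply/negP => h; apply: e_1; exists i'.
  - exact: contrapT e_2.
  - move=> s r; rewrite leNgt; apply/negP => h; apply: e_5; exists s, r; exact: h.
  - by rewrite leNgt; apply/negP.
  - move=> k' dv cl x wx.
    (* The event concerns deviations divided by [mx + 1 / sqrt n] with [mx] the exact sup norm;
       since [mx <= x], multiplying back gives the bound for [x]. *)
    rewrite leNgt; apply/negP => h; apply: e_3; exists k'.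
    have nR : 0 < n%:R :> R by rewrite ltr0n.
    have rn0 : 0 < (Num.sqrt n%:R)^-1 :> R by rewrite invr_gt0 sqrtr_gt0.
    rewrite /dev /scaled_deviation /z cl.
    set mx := \big[Num.max/0]_i0 _.
    have mx0 : 0 <= mx by exact: bigmax_ge_id.
    have x0 : 0 <= x by apply: le_trans (wx k').
    have mxx : mx <= x by apply: bigmax_le => // j _; exact: wx.
    have d1' : 0 < mx + (Num.sqrt n%:R)^-1 := ltr_wpDl mx0 rn0.
    under eq_bigr do rewrite mulrA.
    rewrite -mulr_suml ltr_pdivlMr //; apply: le_lt_trans h.
    by rewrite ler_wpM2l ?mulr_ge0 ?(ltW delta0) // lerD2r.
  - by move=> i'; rewrite leNgt; apply/negP => h; apply: e_4; exists i'.
have := csbm_pr_cover p01 q01 a01 cover.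
rewrite !big_cons big_nil addr0 => tot.
have cl1 (x y : R) : c <= x -> y <= expR (- x * l) -> y <= expR (- c * l).
  by move=> cx h; apply: le_trans h _; rewrite ler_expR !mulNr lerN2 ler_wpM2r.
have cc1 : c <= 1 by rewrite ge_min lexx.
have cm : c <= m / 2 by rewrite !ge_min lexx !orbT.
have ck : c <= th1 * kap / 2 by rewrite !ge_min lexx !orbT.
have ex1 : expR (- l) <= expR (- c * l).
  by apply: (cl1 1) => //; rewrite mulN1r.
have exm := cl1 _ _ cm (lexx _).
have exk := cl1 _ _ ck (lexx _).
have e1' : expR 1 * expR (- l) <= expR 1 * expR (- c * l) by rewrite ler_wpM2l // expR_ge0.
have em' : expR (t * H) * expR (- (m / 2) * l) <= expR (t * H) * expR (- c * l).
  by rewrite ler_wpM2l // expR_ge0.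
move: b4; rewrite -/H => b4.
move: ex1 exm exk e1' em' b1 b2 b3 b4 b5 b6 tot; clear.
rewrite /=; set x := expR (- c * l); lra.
Qed.

Theorem spectral_exact_recovery (u1 : forall n, observation n -> 'rV[R]_n) :
  top_eigenvector_choice M u1 ->
  exact_recovery p q t (fun n G => sign_labels (u1 n G)).
Proof.
move=> top; have [eta eta0 /(_ u1 top)] := spectral_separation.
apply: whp_sub => // n w /existsP[s /forallP sep].
apply/existsP; exists s; apply/forallP => i; have := sep i; rewrite ffunE.
set x := u1 _ _ _ _; rewrite spin_addb => h.
have {}h : 0 < Num.sqrt n%:R * (spin (s (+) sigma0 w i) * x) by apply: lt_le_trans h.
have rn : 0 <= Num.sqrt n%:R :> R by exact: sqrtr_ge0.
have {}h : 0 < spin (s (+) sigma0 w i) * x.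
  rewrite ltNge; apply/negP => h'; move: h; rewrite ltNge => /negP; apply.
  by rewrite mulr_ge0_le0.
move: h; rewrite /spin; case: (s (+) sigma0 w i); rewrite ?expr1 ?expr0 ?mulN1r ?mul1r.
  by rewrite oppr_gt0 => ->.
by move=> /ltW; rewrite leNgt => /negbTE ->.
Qed.

End SpectralRecovery.

Theorem theorem2p2 (R : realType) (p q t : R)
  (p01 : 0 < p < 1) (q01 : 0 < q < 1) (neq_pq : p != q) (t_gt0 : 0 < t)
  (t_gt_tc : t_c p q < t) :
  let A : forall n, observation n -> 'M[R]_n :=
    fun n G => signed_adjacency (y_pq p q) G in
  let conclusions (M : forall n, observation n -> 'M[R]_n) : Prop :=
    (exists2 eta : R, 0 < eta &
       forall u1 : forall n, observation n -> 'rV[R]_n,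
         top_eigenvector_choice M u1 ->
         with_high_probability p q t (fun n (w : outcome n) =>
           [exists s : bool, forall i : 'I_n,
              eta <= Num.sqrt n%:R *
                     (spin s * spin (sigma0 w i) * u1 n (observe w) 0 i)]))
    /\
    (forall u1 : forall n, observation n -> 'rV[R]_n,
       top_eigenvector_choice M u1 ->
       exact_recovery p q t (fun n G => sign_labels (u1 n G))) in
  (q < p -> conclusions A) /\ (p < q -> conclusions (fun n G => - A n G)).
Proof.
move=> A conclusions.
have main (M : forall n, observation n -> 'M[R]_n) cc : 0 < cc ->
    (forall n (w : outcome n) i j, M n (observe w) i j = cc * llr_mx p q w i j) ->
    conclusions M.
  move=> cc0 ME; split.
    exact: (spectral_separation p01 q01 neq_pq t_gt0 t_gt_tc cc0 ME).
  exact: (spectral_exact_recovery p01 q01 neq_pq t_gt0 t_gt_tc cc0 ME).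
have /andP[p0 _] := p01; have /andP[q0 _] := q01.
split=> pq.
- apply: (main A (ln (p / q))^-1) => [|n w i j]; last exact: signed_adjacency_llr.
  by rewrite invr_gt0 ln_gt0 // ltr_pdivlMr // mul1r.
- apply: (main _ (- (ln (p / q))^-1)) => [|n w i j].
    by rewrite oppr_gt0 invr_lt0 ln_lt0 // divr_gt0 //= ltr_pdivrMr // mul1r.
  by rewrite mxE signed_adjacency_llr // mulNr.
Qed.
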